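(* Consider the discounted LQG problem with data $(A,B,W,\nu_0,Q_0,R_0,\alpha)$ and the infinite dimensional linear program (P-SC) described in the context. Let $\hat{\mathcal F}(\mathbb R^n)$ be the set of functions $v(x)=x^TPx+q^Tx+r$ with $P\in\mathcal S^n$, $q\in\mathbb R^n$, $r\in\mathbb R$. Relax the constraint $\nu_0-T\mu=0$ of (P-SC), which is equivalent to $\langle v,\nu_0-T\mu\rangle=0$ for all $v\in\mathcal F(\mathbb R^n)$, by requiring $\langle v,\nu_0-T\mu\rangle=0$ only for all $v\in\hat{\mathcal F}(\mathbb R^n)$. Then, written in terms of the moments $(m,m_x,m_u,Z_{xx},Z_{xu},Z_{uu})$ of $\mu$, this gives the following semidefinite program (P-LQG), which is a relaxation of (P-SC): $$\min\ \operatorname{Tr}(Q_0Z_{xx})+\operatorname{Tr}(R_0Z_{uu})$$ over $m\in\mathbb R$, $m_x\in\mathbb R^n$, $m_u\in\mathbb R^m$, $Z_{xx}\in\mathcal S^n$, $Z_{xu}\in\mathbb R^{n\times m}$, $Z_{uu}\in\mathcal S^m$, subject to $$\text{(C2)}\quad \Sigma_0+m_0m_0^T-Z_{xx}+\alpha\big(AZ_{xx}A^T+AZ_{xu}B^T+BZ_{xu}^TA^T+BZ_{uu}B^T+mW\big)=0,$$ $$\text{(C1)}\quad m_0-m_x+\alpha(Am_x+Bm_u)=0,$$ $$\text{(C0)}\quad \alpha m-m+1=0,$$ $$\text{(Cp)}\quad Z:=\begin{bmatrix} m& m_x^T& m_u^T\\ m_x&Z_{xx}&Z_{xu}\\ m_u&Z_{xu}^T&Z_{uu}\end{bmatrix}\succeq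 0.$$ Precisely: (i) for every $\mu\in\mathcal M_+(\mathbb R^n\times\mathbb R^m)$, one has $\langle v,\nu_0-T\mu\rangle=0$ for all $v\in\hat{\mathcal F}(\mathbb R^n)$ if and only if the moments of $\mu$ satisfy (C0), (C1) and (C2); moreover the moments of $\mu$ satisfy (Cp), and $\langle c_0,\mu\rangle=\operatorname{Tr}(Q_0Z_{xx})+\operatorname{Tr}(R_0Z_{uu})$; (ii) consequently, the moments of every $\mu$ feasible for (P-SC) are feasible for (P-LQG) with the same objective value, so that the optimal value of (P-LQG) is at most that of (P-SC).
   Context: Setting. $x_{t+1}=Ax_t+Bu_t+\omega_t$ with $x_t\in\mathbb R^n$, $u_t\in\mathbb R^m$, $\omega_t$ i.i.d. Gaussian with mean $0$ and covariance $W$; the initial state $x_0$ is independent of the noise and has distribution $\nu_0$ (a probability measure on $\mathbb R^n$ with finite second moments), with mean $m_0$ and covariance $\Sigma_0=E[(x_0-m_0)(x_0-m_0)^T]$. $\mathcal S^n$, $\mathcal S^n_+$, $\mathcal S^n_{++}$ denote the real symmetric, symmetric positive semidefinite and symmetric positive definite $n\times n$ matrices. $Q_0=C^TC\in\mathcal S^n_+$, $R_0\in\mathcal S^m_{++}$, $(A,B)$ is controllable, $(A,C)$ is observable, and $\alpha\in(0,1)$. The running cost is $c_0(x,u)=x^TQ_0x+u^TR_0u$. The transition kernel $\tau(\cdot|x,u)$ is the Gaussian law with mean $Ax+Bu$ and covariance $W$. Spaces. $\mathcal F(\mathbb R^n)$ is the space of real measurable functions on $\mathbb R^n$ growing at most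 quadratically. $\mathcal M(\mathbb R^n\times\mathbb R^m)$ and $\mathcal M(\mathbb R^n)$ are the spaces of finite signed Borel measures with finite second moments (with respect to total variation); $\mathcal M_+$ denotes the cone of nonnegative measures in $\mathcal M$. Operator. For $\mu\in\mathcal M(\mathbb R^n\times\mathbb R^m)$ and Borel $E\subseteq\mathbb R^n$, $$[T\mu](E)=\mu(E\times\mathbb R^m)-\alpha\int_{\mathbb R^n\times\mathbb R^m}\tau(E|x,u)\,\mu(dx,du).$$ Pairings: $\langle c,\mu\rangle=\int c\,d\mu$ on $\mathbb R^n\times\mathbb R^m$ and $\langle v,\nu\rangle=\int v\,d\nu$ on $\mathbb R^n$. Program (P-SC): minimize $\langle c_0,\mu\rangle$ over $\mu\in\mathcal M_+(\mathbb R^n\times\mathbb R^m)$ subject to $\nu_0-T\mu=0$ (equality of measures on $\mathbb R^n$). Moments of $\mu$: $m=\mu(\mathbb R^n\times\mathbb R^m)$, $m_x=\int x\,d\mu$, $m_u=\int u\,d\mu$, $Z_{xx}=\int xx^T\,d\mu$, $Z_{xu}=\int xu^T\,d\mu$, $Z_{uu}=\int uu^T\,d\mu$. *)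

(* Defs.v *)
From HB Require Import structures.
From mathcomp Require Import all_boot all_order all_algebra.
From mathcomp Require Import all_classical all_reals all_analysis.

Set Implicit Arguments.
Unset Strict Implicit.
Unset Printing Implicit Defensive.

Import Order.TTheory GRing.Theory Num.Theory.
Import numFieldNormedType.Exports.

Local Open Scope classical_set_scope.
Local Open Scope ring_scope.

(* The library has no sigma-algebra on matrices; this puts the Borel one on
   them.  The product sigma-algebra on 'cV[R]_n * 'cV[R]_m is then the Borel
   one too, these spaces being second countable. *)
Section borel_matrix.
Variables (R : realType) (m n : nat).
Let G := @open 'M[R]_(m, n).

HB.instance Definition _ := @isMeasurable.Build (sigma_display G) 'M[R]_(m, n)
  <<s G >> (@sigma_algebra0 _ setT G) (@sigma_algebraC _ G)
  (@sigma_algebra_bigcup _ setT G).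
End borel_matrix.

Section linear_algebra.
Variable R : realType.

Definition is_psd n (M : 'M[R]_n) : Prop :=
  M^T = M /\ forall x : 'cV[R]_n, 0 <= (x^T *m M *m x) 0 0.

Definition is_pd n (M : 'M[R]_n) : Prop :=
  M^T = M /\ forall x : 'cV[R]_n, x != 0 -> 0 < (x^T *m M *m x) 0 0.

Definition normsq n (x : 'cV[R]_n) : R := \sum_i x i 0 ^+ 2.

Fixpoint trajectory n m (A : 'M[R]_n) (B : 'M[R]_(n, m)) (x : 'cV[R]_n)
    (u : nat -> 'cV[R]_m) (t : nat) : 'cV[R]_n :=
  if t is s.+1 then A *m trajectory A B x u s + B *m u s else x.

Definition controllable n m (A : 'M[R]_n) (B : 'M[R]_(n, m)) : Prop :=
  forall x y : 'cV[R]_n, exists (t : nat) (u : nat -> 'cV[R]_m),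
    trajectory A B x u t = y.

(* the uncontrolled output sequence C A^t x determines the initial state x *)
Definition observable n p (A : 'M[R]_n) (C : 'M[R]_(p, n)) : Prop :=
  forall x y : 'cV[R]_n,
    (forall t, C *m iter t (mulmx A) x = C *m iter t (mulmx A) y) -> x = y.

End linear_algebra.

Section gaussian.
Variable R : realType.

(* N(a, v) on the line, parametrized by the variance; degenerate if v = 0,
   a case in which normal_prob is not the expected Dirac mass *)
Definition gauss1 (a v : R) (E : set R) : \bar R :=
  if v == 0 then \d_a E else normal_prob a (Num.sqrt v) E.

(* The possibly degenerate Gaussian law N(a, W) on R^n: every linear functional
   c^T y has law N(c^T a, c^T W c). *)
Definition is_gaussian n (a : 'cV[R]_n) (W : 'M[R]_n)
    (P : set 'cV[R]_n -> \bar R) : Prop :=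
  forall (c : 'cV[R]_n) (E : set R), measurable E ->
    P [set y | E ((c^T *m y) 0 0)] =
    gauss1 ((c^T *m a) 0 0) ((c^T *m W *m c) 0 0) E.

End gaussian.

Section signed_integral.
Context d (T : measurableType d) (R : realType).
Variable nu : {charge set T -> \bar R}.

Lemma hahn_ex : exists PN : set T * set T, hahn_decomposition nu PN.1 PN.2.
Proof. by have [P [N h]] := Hahn_decomposition nu; exists (P, N). Qed.

(* the Jordan parts do not depend on the Hahn decomposition chosen here *)
Definition hahn_pair := sval (cid hahn_ex).
Definition hahnP : hahn_decomposition nu hahn_pair.1 hahn_pair.2 :=
  svalP (cid hahn_ex).

Definition cpos : {finite_measure set T -> \bar R} := jordan_pos hahnP.
Definition cneg : {finite_measure set T -> \bar R} := jordan_neg hahnP.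

Definition cint (f : T -> \bar R) : \bar R :=
  (\int[cpos]_x f x - \int[cneg]_x f x)%E.

Definition pairing (v : T -> R) : \bar R := cint (fun x => (v x)%:E).

End signed_integral.

Section mixture.
Context d1 d2 (X : measurableType d1) (Y : measurableType d2) (R : realType).
Variables (k : R.-pker X ~> Y) (mu : {finite_measure set X -> \bar R}).
Local Open Scope ereal_scope.

Definition mixture (E : set Y) : \bar R := \int[mu]_x k x E.

Let mixture0 : mixture set0 = 0.
Proof.
by rewrite /mixture (eq_integral (cst 0)) ?integral0// => x _; rewrite measure0.
Qed.

Let mixture_ge0 E : 0 <= mixture E. Proof. exact: integral_ge0. Qed.

Let mixture_sigma_additive : semi_sigma_additive mixture.
Proof.
move=> U mU tU mUU; rewrite [X in _ --> X](_ : _ =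
  \int[mu]_x (\sum_(n <oo) k x (U n))); last first.
  apply: eq_integral => V _.
  by apply/esym/cvg_lim => //; exact/measure_semi_sigma_additive.
apply/cvg_closeP; split.
  by apply: is_cvg_nneseries => n _ _; exact: integral_ge0.
rewrite closeE// integral_nneseries// => n.
exact: measurable_kernel.
Qed.

HB.instance Definition _ := isMeasure.Build _ _ R
  mixture mixture0 mixture_ge0 mixture_sigma_additive.

Let mixture_fin : fin_num_fun mixture.
Proof.
move=> E mE; rewrite ge0_fin_numE//.
apply: (@le_lt_trans _ _ (\int[mu]_x (cst 1 x))).
  apply: ge0_le_integral => //.
  - exact: measurable_kernel.
  - by move=> x _; rewrite /= -(@prob_kernel _ _ _ _ _ k x) le_measure ?inE.
by rewrite integral_cst// mul1e -ge0_fin_numE// fin_num_measure.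
Qed.

HB.instance Definition _ := @Measure_isFinite.Build _ _ _ mixture mixture_fin.

End mixture.

Section operator.
Context (R : realType) (n m : nat).
Variables (alpha : R) (tau : R.-pker ('cV[R]_n * 'cV[R]_m)%type ~> 'cV[R]_n).
Variable mu : {charge set ('cV[R]_n * 'cV[R]_m)%type -> \bar R}.
Local Open Scope ereal_scope.

Definition T_op (E : set 'cV[R]_n) : \bar R :=
  mu (E `*` setT) - alpha%:E * cint mu (fun z => tau z E).

Let T_charge : {charge set 'cV[R]_n -> \bar R} :=
  cadd (measure_function_pushforward__canonical__charge_Charge mu
          (@measurable_fst _ _ 'cV[R]_n 'cV[R]_m))
    (cscale (- alpha) (cadd (charge_of_finite_measure (mixture tau (cpos mu)))
       (copp (charge_of_finite_measure (mixture tau (cneg mu)))))).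

Let T_opE : T_op = T_charge.
Proof.
apply/funext => E.
rewrite /T_op -mulNe; congr (_ + _).
by congr (mu _); apply/seteqP; split=> -[x u] //= [].
Qed.

Let T_op0 : T_op set0 = 0. Proof. by rewrite T_opE charge0. Qed.

Let T_op_fin E : measurable E -> T_op E \is a fin_num.
Proof. by move=> mE; rewrite T_opE fin_num_measure. Qed.

Let T_op_sigma_additive : semi_sigma_additive T_op.
Proof. rewrite T_opE; exact: charge_semi_sigma_additive. Qed.

HB.instance Definition _ := isCharge.Build _ _ R T_op
  T_op0 T_op_fin T_op_sigma_additive.

End operator.

Section programs.
Context (R : realType) (n m : nat).
Local Notation X := 'cV[R]_n.
Local Notation XU := ('cV[R]_n * 'cV[R]_m)%type.

Definition second_moments1 (nu : {finite_measure set X -> \bar R}) : Prop :=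
  nu.-integrable setT (fun x => (normsq x)%:E).

(* The cone M_+(R^n * R^m): a nonnegative measure is its own total variation,
   so the second moments are taken with respect to mu itself. *)
Definition in_Mplus (mu : {finite_measure set XU -> \bar R}) : Prop :=
  mu.-integrable setT (fun z => (normsq z.1 + normsq z.2)%:E).

Definition in_F (v : X -> R) : Prop :=
  measurable_fun setT v /\
  exists K : R, forall x, `|v x| <= K * (1 + normsq x).

Definition in_Fhat (v : X -> R) : Prop :=
  exists (P : 'M[R]_n) (q : X) (r : R), P^T = P /\
    v = fun x => (x^T *m P *m x) 0 0 + (q^T *m x) 0 0 + r.

Definition mean (nu : {finite_measure set X -> \bar R}) : X :=
  \col_i \int[nu]_x x i 0.

Definition covariance_mx (nu : {finite_measure set X -> \bar R}) : 'M[R]_n :=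
  \matrix_(i, j)
    \int[nu]_x ((x i 0 - mean nu i 0) * (x j 0 - mean nu j 0)).

Definition cost (Q0 : 'M[R]_n) (R0 : 'M[R]_m) (z : XU) : R :=
  (z.1^T *m Q0 *m z.1) 0 0 + (z.2^T *m R0 *m z.2) 0 0.

(* the signed measure nu0 - T mu, for mu in M_+ *)
Definition residual (alpha : R) (tau : R.-pker XU ~> X)
    (nu0 : {finite_measure set X -> \bar R})
    (mu : {finite_measure set XU -> \bar R}) : {charge set X -> \bar R} :=
  cadd (charge_of_finite_measure nu0)
    (copp (T_op alpha tau (charge_of_finite_measure mu))).

Definition psc_feasible alpha tau nu0 mu : Prop :=
  in_Mplus mu /\
  forall E : set X, measurable E -> residual alpha tau nu0 mu E = 0%E.

Definition psc_value Q0 R0 alpha tau nu0 : \bar R :=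
  ereal_inf [set (\int[mu]_z (cost Q0 R0 z)%:E)%E
            | mu in [set mu | psc_feasible alpha tau nu0 mu]].

Record lqg_var := LqgVar {
  v_m : R;
  v_mx : 'cV[R]_n;
  v_mu : 'cV[R]_m;
  v_Zxx : 'M[R]_n;
  v_Zxu : 'M[R]_(n, m);
  v_Zuu : 'M[R]_m }.

Definition moments (mu : {finite_measure set XU -> \bar R}) : lqg_var :=
  {| v_m := fine (mu setT);
     v_mx := \col_i \int[mu]_z z.1 i 0;
     v_mu := \col_i \int[mu]_z z.2 i 0;
     v_Zxx := \matrix_(i, j) \int[mu]_z (z.1 i 0 * z.1 j 0);
     v_Zxu := \matrix_(i, j) \int[mu]_z (z.1 i 0 * z.2 j 0);
     v_Zuu := \matrix_(i, j) \int[mu]_z (z.2 i 0 * z.2 j 0) |}.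

Definition constraint_C0 (alpha : R) (w : lqg_var) : Prop :=
  alpha * v_m w - v_m w + 1 = 0.

Definition constraint_C1 (A : 'M[R]_n) (B : 'M[R]_(n, m)) (alpha : R) (m0 : X)
    (w : lqg_var) : Prop :=
  m0 - v_mx w + alpha *: (A *m v_mx w + B *m v_mu w) = 0.

Definition constraint_C2 (A : 'M[R]_n) (B : 'M[R]_(n, m)) (W : 'M[R]_n)
    (alpha : R) (m0 : X) (Sigma0 : 'M[R]_n) (w : lqg_var) : Prop :=
  Sigma0 + m0 *m m0^T - v_Zxx w +
  alpha *: (A *m v_Zxx w *m A^T + A *m v_Zxu w *m B^T +
            B *m (v_Zxu w)^T *m A^T + B *m v_Zuu w *m B^T + v_m w *: W) = 0.

Definition constraint_Cp (w : lqg_var) : Prop :=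
  is_psd (block_mx (v_m w)%:M (row_mx (v_mx w)^T (v_mu w)^T)
                   (col_mx (v_mx w) (v_mu w))
                   (block_mx (v_Zxx w) (v_Zxu w) (v_Zxu w)^T (v_Zuu w))
          : 'M[R]_(1 + (n + m))).

Definition lqg_feasible A B W alpha m0 Sigma0 (w : lqg_var) : Prop :=
  [/\ (v_Zxx w)^T = v_Zxx w, (v_Zuu w)^T = v_Zuu w,
      constraint_C2 A B W alpha m0 Sigma0 w,
      constraint_C1 A B alpha m0 w
    & constraint_C0 alpha w /\ constraint_Cp w].

Definition lqg_obj (Q0 : 'M[R]_n) (R0 : 'M[R]_m) (w : lqg_var) : R :=
  \tr (Q0 *m v_Zxx w) + \tr (R0 *m v_Zuu w).

Definition lqg_value A B W alpha m0 Sigma0 Q0 R0 : \bar R :=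
  ereal_inf [set (lqg_obj Q0 R0 w)%:E
            | w in [set w | lqg_feasible A B W alpha m0 Sigma0 w]].

End programs.

(* Main.v *)
(* For mu in M_+, nu0 - T mu = p - q with p = nu0 + alpha * mixture(tau, mu) and
   q the x-marginal of mu, two finite measures with finite second moments.
   Hence, whatever the Jordan decomposition is, <v, nu0 - T mu> equals
   int v dp - int v dq for every v of at most quadratic growth.  A Gaussian
   step N(Ax + Bu, W) has mean Ax + Bu and second moment matrix
   W + (Ax + Bu)(Ax + Bu)^T, so integrating it against mu gives the moments of
   the mixture, and for v(x) = x^T P x + q^T x + r the pairing becomes
   tr(P C2) + q^T C1 + r C0, where Ci is the left-hand side of constraint (Ci).
   This vanishes for all P, q, r iff C0, C1, C2 do: take P = C2, then q = C1.
   The matrix in (Cp) is the second moment matrix of the vector (1, x, u). *)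
Require Import Defs.
From HB Require Import structures.
From mathcomp Require Import all_boot all_order all_algebra.
From mathcomp Require Import all_classical all_reals all_analysis.
From mathcomp Require Import measurable_realfun ring lra.

Set Implicit Arguments.
Unset Strict Implicit.
Unset Printing Implicit Defensive.

Import Order.TTheory GRing.Theory Num.Theory.
Import numFieldNormedType.Exports.

Local Open Scope classical_set_scope.
Local Open Scope ring_scope.

(** * Moments of the normal law *)

(** Two obstacles shape the proof. [is_gaussian] gives no density of the vector: it prescribes only
    the laws of the scalar projections [c^T y]. The moments of a Gaussian step are therefore read
    off the scalar normal law, a projection of zero variance being a Dirac mass, and the second
    moment matrix is recovered from its quadratic form by polarization. The scalar facts are first
    proved for nonnegative integrands, where substitution and exchange of integrals need no prior
    integrability; that the mean is right thus appears as an equality between the integrals of a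
    positive and a negative part.

    The pairing with a charge goes through a Hahn decomposition that is never computed. Once the
    charge is written as [p - q], its Jordan parts are dominated by [p] and [q], so integrability
    carries over to them, and the identity [cpos + q = cneg + p] between measures can be integrated
    and rearranged among finite numbers. The same device evaluates the integral of the kernel inside
    [T_op]. *)

Section half_line_gauss_moments.
Context {R : realType}.
Let mu := @lebesgue_measure R.

Lemma is_derive_gauss_fun (x : R) :
  is_derive x 1 (@gauss_fun R) (- 2 * x * gauss_fun x).
Proof.
rewrite /gauss_fun; apply: is_derive_eq.
rewrite /GRing.scale/=; ring.
Qed.

Lemma gauss_fun_le_inv (x : R) : 0 < x -> gauss_fun x <= (x ^+ 2)^-1.
Proof.
move=> x0; rewrite /gauss_fun expRN lef_pV2 ?posrE ?expR_gt0 ?exprn_gt0//.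
by apply: le_trans (expR_ge1Dx _); rewrite lerDr.
Qed.

Lemma cvg_mul_gauss_fun : x * @gauss_fun R x @[x --> +oo] --> (0 : R).
Proof.
apply: (@squeeze_cvgr _ _ _ _ (cst 0) (fun x : R => x^-1)).
- near=> x; have x0 : 0 < x by near: x; exact: nbhs_pinfty_gt.
  apply/andP; split; first by rewrite mulr_ge0 ?gauss_fun_ge0 ?ltW.
  have h := ler_wpM2l (ltW x0) (gauss_fun_le_inv x0).
  apply: (le_trans h).
  by rewrite expr2 invfM mulrA divff ?gt_eqF// mul1r.
- exact: cvg_cst.
- apply/gtr0_cvgV0; last exact: cvg_id.
  exact: nbhs_pinfty_gt.
Unshelve. all: by end_near. Qed.

Import gauss_integral_proof.

(** The known limit is that of the square, [pi / 4]; the integral is nonnegative, so square roots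
    can be taken. *)
Lemma cvg_integral0_gauss :
  @integral0_gauss R x @[x --> +oo] --> Num.sqrt pi / 2.
Proof.
have : Num.sqrt (@integral0_gauss R x ^+ 2) @[x --> +oo] --> Num.sqrt (pi / 4).
  by apply: continuous_cvg; [exact: sqrt_continuous
                            |exact: cvg_integral0_gauss_sqr].
rewrite sqrtrM ?pi_ge0// sqrtrV// (_ : 4 = 2 ^+ 2); last by ring.
rewrite sqrtr_sqr ger0_norm//.
rewrite (_ : (fun _ => Num.sqrt _) = integral0_gauss)//; apply/funext => r.
by rewrite sqrtr_sqr ger0_norm// integral0_gauss_ge0.
Qed.

Lemma integral0y_sqr_gauss :
  (\int[mu]_(x in `[0%R, +oo[) (x ^+ 2 * gauss_fun x)%:E)%E =
  (Num.sqrt pi / 4)%:E.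
Proof.
have ig (a b : R) : mu.-integrable `[a, b] (EFin \o gauss_fun).
  apply: continuous_compact_integrable; first exact: segment_compact.
  by apply: continuous_subspaceT; exact: continuous_gauss_fun.
have dI (x : R) : 0 < x -> is_derive x 1 (@integral0_gauss R) (gauss_fun x).
  move=> x0; have [dx xE] := @continuous_FTC1 R gauss_fun (BLeft 0) x (x + 1)
    (ltr_pwDr ltr01 (lexx x)) (ig _ _) x0 (@continuous_gauss_fun R x).
  by apply: DeriveDef; [exact: dx|rewrite -derive1E; exact: xE].
(* Integration by parts of [t * (t * gauss_fun t)] yields this antiderivative; it vanishes at 0 and
   tends to [Num.sqrt pi / 4]. *)
pose F (x : R) := 2^-1 * (integral0_gauss x - x * gauss_fun x).
rewrite (@ge0_continuous_FTC2y _ _ F 0 (2^-1 * (Num.sqrt pi / 2 - 0))).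
- rewrite /F /integral0_gauss set_itv1 Rintegral_set1 -EFinB; congr EFin.
  by field.
- by move=> x x0; rewrite mulr_ge0 ?gauss_fun_ge0 ?sqr_ge0.
- apply: continuous_subspaceT => x.
  by apply: cvgM; [exact: exprn_continuous|exact: continuous_gauss_fun].
- apply: cvgM; first exact: cvg_cst.
  by apply: cvgB; [exact: cvg_integral0_gauss|exact: cvg_mul_gauss_fun].
- move=> x x0; apply: derivableM => //; apply: derivableB.
    by have [] := dI x x0.
  by apply: derivableM => //; have [] := is_derive_gauss_fun x.
- apply: cvgM; first exact: cvg_cst.
  apply: cvgB; last first.
    apply: cvg_at_right_filter; apply: cvgM; first exact: cvg_id.
    exact: continuous_gauss_fun.
  (* [dI] differentiates [integral0_gauss] only at positive points, so right continuity at 0 comes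
     from continuity of the integral in its upper bound. *)
  have /continuous_within_itvP :
      {within `[0, 1], continuous (@integral0_gauss R)}.
    exact: parameterized_integral_continuous.
  by move=> /(_ ltr01)[].
- move=> x; rewrite in_itv/= andbT => x0; rewrite derive1E.
  have := is_derive_gauss_fun x => ?; have := dI x x0 => ?.
  rewrite derive_val /GRing.scale/=; by field.
Qed.

End half_line_gauss_moments.

(** * Integration against a mixture of measures *)

Section integral_mixture.
Local Open Scope ereal_scope.
Context d1 d2 (X : measurableType d1) (Y : measurableType d2) (R : realType).
Variables (k : X -> {measure set Y -> \bar R})
  (mu : {measure set X -> \bar R}) (nu : {measure set Y -> \bar R}).
Hypothesis mk : forall U : set Y, measurable U ->
  measurable_fun [set: X] (fun x => k x U).
Hypothesis nuE : forall U : set Y, d2.-measurable U -> nu U = \int[mu]_x k x U.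
Import HBNNSimple.

Let ge0_integral_mixture_nnsfun (f : {nnsfun Y >-> R}) :
  \int[nu]_y (f y)%:E = \int[mu]_x (\int[k x]_y (f y)%:E).
Proof.
have mf r : measurable (f @^-1` [set r]) by exact: measurable_sfunP.
have sE (l : {measure set Y -> \bar R}) : \int[l]_y (f y)%:E =
    \sum_(r \in range f) (r%:E * l (f @^-1` [set r])).
  by rewrite integralT_nnsfun sintegralE.
rewrite sE; under [RHS]eq_integral do rewrite sE.
rewrite ge0_integral_fsum//; last 2 first.
  - by move=> r; apply: measurable_funeM; exact: mk.
  - move=> r x _; exact: (mulemu_ge0 (fun r => f @^-1` [set r])
      (fun r0 => preimage_nnfun0 f r0)).
(* For negative [r] the preimage is empty and both terms vanish. *)
apply: eq_fsbigr => r _; have [r0|r0] := leP 0%R r.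
  by rewrite nuE// ge0_integralZl//; exact: mk.
rewrite preimage_nnfun0// measure0 mule0.
rewrite [RHS](eq_integral (cst 0)) ?integral0// => x _.
by rewrite measure0 mule0.
Qed.

Lemma ge0_integral_mixture (f : Y -> \bar R) :
  (forall y, 0 <= f y) -> measurable_fun [set: Y] f ->
  \int[nu]_y f y = \int[mu]_x (\int[k x]_y f y).
Proof.
move=> f0 mf; pose f_ := nnsfun_approx measurableT mf.
have cvgf (l : {measure set Y -> \bar R}) :
    \int[l]_y f y = limn (fun n => \int[l]_y (f_ n y)%:E).
  rewrite -monotone_convergence//.
  - apply: eq_integral => y _; apply/esym/cvg_lim => //.
    exact: cvg_nnsfun_approx.
  - by move=> n; exact/measurable_EFinP.
  - by move=> n z _; rewrite lee_fin.
  - by move=> z _ a b ab; rewrite lee_fin; exact/lefP/nd_nnsfun_approx.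
rewrite cvgf; under [RHS]eq_integral do rewrite cvgf.
rewrite monotone_convergence//.
- by congr (limn _); apply/funext => n; rewrite ge0_integral_mixture_nnsfun.
- move=> n; apply: measurable_fun_integral_kernel => //.
    by move=> z; rewrite lee_fin.
  exact/measurable_EFinP.
- by move=> n y _; apply: integral_ge0 => // z _; rewrite lee_fin.
- move=> x _ a b ab; apply: ge0_le_integral => //.
  + by move=> z _; rewrite lee_fin.
  + exact/measurable_EFinP.
  + exact/measurable_EFinP.
  + by move=> z _; rewrite lee_fin; exact/lefP/nd_nnsfun_approx.
Qed.

(** Split [f] into positive and negative parts. The nonnegative case, applied to each part, also
    shows that the inner integrals are [mu]-integrable, so the outer integral may be subtracted. *)
Lemma integral_mixture (f : Y -> \bar R) :
  (forall x, (k x).-integrable setT f) -> nu.-integrable setT f ->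
  \int[nu]_y f y = \int[mu]_x (\int[k x]_y f y).
Proof.
move=> kf nuf; have mf := measurable_int _ nuf.
have mfp : measurable_fun setT f^\+ by exact: measurable_funepos.
have mfn : measurable_fun setT f^\- by exact: measurable_funeneg.
have ik (g : Y -> \bar R) : (forall y, 0 <= g y) -> nu.-integrable setT g ->
    mu.-integrable setT (fun x => \int[k x]_y g y).
  move=> g0 nug; have mg := measurable_int _ nug.
  apply/integrableP; split; first exact: measurable_fun_integral_kernel.
  rewrite (eq_integral (fun x => \int[k x]_y g y)); last first.
    by move=> x _; rewrite gee0_abs// integral_ge0.
  by rewrite -ge0_integral_mixture// integrable_lty.
rewrite [LHS]integralE !ge0_integral_mixture// -integralB//.
- by apply: eq_integral => x _; rewrite [RHS]integralE.
- by apply: ik => //; exact: integrable_funepos.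
- by apply: ik => //; exact: integrable_funeneg.
Qed.

End integral_mixture.

(* The measure [nu] is the mixture of the point masses [g x * \d_x]. *)
Lemma ge0_integral_density d (T : measurableType d) (R : realType)
    (mu nu : {measure set T -> \bar R}) (g : T -> R) (f : T -> \bar R) :
  (forall x, 0 <= g x) -> measurable_fun [set: T] g ->
  (forall U : set T, d.-measurable U -> nu U = (\int[mu]_(x in U) (g x)%:E)%E) ->
  (forall x, (0 <= f x)%E) -> measurable_fun [set: T] f ->
  (\int[nu]_x f x = \int[mu]_x ((g x)%:E * f x))%E.
Proof.
move=> g0 mg nuE f0 mf.
pose k x : {measure set T -> \bar R} := mscale (NngNum (g0 x)) (dirac x).
have kE x U : k x U = (g x * \1_U x)%:E.
  by rewrite /k/= /mscale/= diracE indicE.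
rewrite (@ge0_integral_mixture _ _ _ _ _ k mu)//.
- apply: eq_integral => x _.
  by rewrite ge0_integral_mscale//= integral_dirac// diracT mul1e.
- move=> U mU; under eq_fun do rewrite kE.
  by apply/measurable_EFinP; apply: measurable_funM => //; exact: measurable_indic.
- move=> U mU; rewrite nuE// integral_mkcond; apply: eq_integral => x _.
  rewrite kE patchE indicE; case: ifPn => _ /=; first by rewrite mulr1.
  by rewrite mulr0.
Qed.

(** Cutting the line at 0 and reflecting the negative half turns either side into the same two
    integrals over the nonnegative half-line, in opposite order. *)
Lemma ge0_integral_oppr (R : realType) (h : R -> R) :
  (forall x, 0 <= h x) -> continuous h ->
  (\int[@lebesgue_measure R]_x (h x)%:E =
   \int[@lebesgue_measure R]_x (h (- x))%:E)%E.
Proof.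
have split (f : R -> R) : (forall x, 0 <= f x) -> continuous f ->
    (\int[@lebesgue_measure R]_x (f x)%:E =
     \int[@lebesgue_measure R]_(x in `[0%R, +oo[) (f (- x))%:E +
     \int[@lebesgue_measure R]_(x in `[0%R, +oo[) (f x)%:E)%E.
  move=> f0 cf.
  have mf D : measurable_fun D (EFin \o f).
    apply: measurable_funTS; apply/measurable_EFinP.
    exact: continuous_measurable_fun.
  (* The endpoint is written [- 0] to match the reflection substitution. *)
  rewrite -(setUv `]-oo, (- 0)%R]%classic) ge0_integral_setU//=; last 4 first.
  - exact: measurableC.
  - exact: mf.
  - by move=> x _; rewrite lee_fin.
  - by rewrite disj_set2E setICr.
  rewrite ge0_integration_by_substitutionNy//; last first.
    exact: continuous_subspaceT.
  congr (_ + _)%E; rewrite setCitvl oppr0 integral_itv_obnd_cbnd//; exact: mf.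
move=> h0 ch; rewrite split// [RHS](split (h \o -%R))//=; last first.
  move=> x; apply: (@continuous_comp _ _ _ -%R h); last exact: ch.
  exact: opp_continuous.
by rewrite addeC; congr (_ + _)%E; apply: eq_integral => x _; rewrite /= opprK.
Qed.

(** * Mean and variance of the scalar normal law *)

Section normal_moments.
Context {R : realType}.
Let mu := @lebesgue_measure R.
Variables (m s : R) (s0 : 0 < s).

(** Standardization [x = m + Num.sqrt 2 * s * z]. The factor [Num.sqrt 2] is there because
    [gauss_fun z] is [exp(- z^2)], without the usual one half; the peak [1 / sqrt(2 pi s^2)] times
    the Jacobian leaves [1 / sqrt pi]. *)
Lemma ge0_integral_normal_prob (f : R -> R) :
  (forall x, 0 <= f x) -> continuous f ->
  (\int[normal_prob m s]_x (f x)%:E =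
   \int[mu]_z ((Num.sqrt pi)^-1 * (f (m + Num.sqrt 2 * s * z) * gauss_fun z))%:E)%E.
Proof.
move=> f0 cf.
have c0 : 0 < Num.sqrt 2 * s by rewrite mulr_gt0// sqrtr_gt0.
have cn0 : Num.sqrt 2 * s != 0 by rewrite gt_eqF.
rewrite (@ge0_integral_density _ _ _ mu _ (normal_pdf m s)); first last.
- by apply/measurable_EFinP; exact: continuous_measurable_fun.
- by move=> x; rewrite lee_fin.
- by [].
- exact: measurable_normal_pdf.
- exact: normal_pdf_ge0.
(* The substitution is performed on the right-hand side, hence the inverse map. *)
pose F (x : R) := (x - m) / (Num.sqrt 2 * s).
have dF (x : R) : is_derive x 1 F (Num.sqrt 2 * s)^-1.
  rewrite /F; apply: is_derive_eq.
  by rewrite /GRing.scale/=; ring.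
have F'E : F^`()%classic = cst (Num.sqrt 2 * s)^-1.
  by apply/funext => x; rewrite derive1E; apply: derive_val.
rewrite [RHS](@increasing_ge0_integration_by_substitutionT _ F).
- apply: eq_integral => x _; rewrite -EFinM; congr EFin.
  rewrite normal_pdfE ?gt_eqF// /normal_peak /normal_fun F'E /=.
  rewrite fctE/= /F (mulrC (Num.sqrt 2 * s)) divfK// subrKC /gauss_fun.
  rewrite exprMn exprVn exprMn sqr_sqrtr// mulNr mulr_natl.
  have -> : s ^+ 2 * pi *+ 2 = 2 * (s ^+ 2 * pi) :> R by ring.
  rewrite (sqrtrM (s ^+ 2 * pi)) ?ler0n// (sqrtrM pi (sqr_ge0 s)) sqrtr_sqr.
  by rewrite gtr0_norm// !invfM; ring.
- by move=> x y xy; rewrite /F ltr_pM2r ?invr_gt0// ltrD2r.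
- by rewrite F'E => ?; exact: cvg_cst.
- by rewrite F'E; exact: is_cvg_cst.
- by rewrite F'E; exact: is_cvg_cst.
- by move=> x; have [] := dF x.
- apply/gt0_cvgMlNy; last exact: cvg_addrr_Ny.
  by rewrite invr_gt0.
- apply/gt0_cvgMly; last exact: cvg_addrr.
  by rewrite invr_gt0.
- move=> x; apply: cvgM; first exact: cvg_cst.
  apply: cvgM; last exact: continuous_gauss_fun.
  apply: (@continuous_comp _ _ _ (fun z : R => m + Num.sqrt 2 * s * z) f).
    apply: cvgD; first exact: cvg_cst.
    by apply: cvgM; [exact: cvg_cst|exact: cvg_id].
  exact: cf.
- by move=> x; rewrite !mulr_ge0 ?invr_ge0 ?sqrtr_ge0 ?gauss_fun_ge0.
Qed.

(** After standardization the integrand is [2 s^2 z^2 exp(- z^2) / sqrt pi]; it is even, so twice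
    the half-line value [sqrt pi / 4] gives [s^2]. *)
Lemma normal_prob_variance :
  (\int[normal_prob m s]_x ((x - m) ^+ 2)%:E = (s ^+ 2)%:E)%E.
Proof.
have h0 x : 0 <= x ^+ 2 * gauss_fun x :> R.
  by rewrite mulr_ge0 ?sqr_ge0 ?gauss_fun_ge0.
have ch : continuous (fun x : R => x ^+ 2 * gauss_fun x).
  by move=> x; apply: cvgM; [exact: exprn_continuous|exact: continuous_gauss_fun].
rewrite ge0_integral_normal_prob; last 2 first.
- by move=> x; exact: sqr_ge0.
- move=> x.
  apply: (@continuous_comp _ _ _ (fun x : R => x - m) (fun x : R => x ^+ 2)).
    by apply: cvgB; [exact: cvg_id|exact: cvg_cst].
  exact: exprn_continuous.
transitivity (\int[mu]_x (((Num.sqrt pi)^-1 * (s ^+ 2 *+ 2))%:E *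
    (x ^+ 2 * gauss_fun x)%:E))%E.
  apply: eq_integral => x _; rewrite -EFinM; congr EFin.
  by rewrite addrC addKr exprMn exprMn sqr_sqrtr// -mulr_natr; ring.
rewrite ge0_integralZl//; first last.
- by rewrite lee_fin mulr_ge0 ?invr_ge0 ?sqrtr_ge0 ?mulrn_wge0 ?sqr_ge0.
- by move=> x _; rewrite lee_fin.
- by apply/measurable_EFinP; exact: continuous_measurable_fun.
rewrite ge0_symfun_integralT//; last first.
  by move=> x /=; rewrite /gauss_fun sqrrN.
rewrite (_ : [set x | _] = `[0, +oo[%classic); last first.
  by apply/seteqP; split => x/=; rewrite in_itv/= andbT.
rewrite integral0y_sqr_gauss -!EFinM; congr EFin.
have : Num.sqrt pi != 0 :> R by rewrite sqrtr_eq0 -ltNge pi_gt0.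
by rewrite -mulr_natr => ?; field.
Qed.

(** This is the statement that the mean is [m], phrased without signed integrals: after
    standardization, [z -> - z] exchanges the two parts and fixes [gauss_fun]. *)
Lemma normal_prob_centered_parts :
  (\int[normal_prob m s]_x (Num.max (x - m) 0)%:E =
   \int[normal_prob m s]_x (Num.max (- (x - m)) 0)%:E)%E.
Proof.
have cB : continuous (fun x : R => x - m).
  by move=> x; apply: cvgB; [exact: cvg_id|exact: cvg_cst].
have cN : continuous (fun x : R => - (x - m)).
  by move=> x; apply: (@cvgN _ R^o); exact: cB.
have cmax (h : R -> R) : continuous h -> continuous (fun x => Num.max (h x) 0).
  move=> ch; apply: (@max_fun_continuous _ _ _ h (cst 0)) => // x; exact: cvg_cst.
rewrite !ge0_integral_normal_prob; first last.
- exact: (cmax _ cB).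
- by move=> x; rewrite le_max lexx orbT.
- exact: (cmax _ cN).
- by move=> x; rewrite le_max lexx orbT.
rewrite ge0_integral_oppr.
- apply: eq_integral => x _ /=; congr (_ * (_ * _))%:E; last first.
    by rewrite /gauss_fun sqrrN.
  by congr Num.max; ring.
- move=> x; rewrite !mulr_ge0 ?invr_ge0 ?sqrtr_ge0 ?gauss_fun_ge0//.
  by rewrite le_max lexx orbT.
- move=> x; apply: cvgM; first exact: cvg_cst.
  apply: cvgM; last exact: continuous_gauss_fun.
  apply: (cmax (fun z => m + Num.sqrt 2 * s * z - m)) => z.
  apply: cvgB; last exact: cvg_cst.
  apply: cvgD; first exact: cvg_cst.
  by apply: cvgM; [exact: cvg_cst|exact: cvg_id].
Qed.

End normal_moments.

(** * First and second moments of random vectors *)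

Lemma measurable_coord {R : realType} m n i j :
  measurable_fun setT (fun M : 'M[R]_(m, n) => M i j).
Proof.
apply: (measurability _ (RGenOpens.measurableE R)) => _ [_ [a [b ->] <-]].
rewrite setTI; apply: sub_sigma_algebra.
have /continuousP := @coord_continuous R m n i j; apply.
exact: interval_open.
Qed.

Lemma quad_formE {R : realType} n (P : 'M[R]_n) (x : 'cV[R]_n) :
  (x^T *m P *m x) 0 0 = \sum_i \sum_j P i j * (x i 0 * x j 0).
Proof.
rewrite mxE exchange_big; apply: eq_bigr => j _ /=.
rewrite mxE mulr_suml; apply: eq_bigr => i _.
by rewrite mxE; ring.
Qed.

Lemma dotE {R : realType} n (q x : 'cV[R]_n) :
  (q^T *m x) 0 0 = \sum_i q i 0 * x i 0.
Proof. by rewrite mxE; apply: eq_bigr => i _; rewrite mxE. Qed.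

Section moment_vectors.
Context d (T : measurableType d) (R : realType).
Variable mu : {measure set T -> \bar R}.

Lemma integrableT_sum (I : Type) (s : seq I) (f : I -> T -> R) :
  (forall i, mu.-integrable setT (EFin \o f i)) ->
  mu.-integrable setT (EFin \o (fun x => \sum_(i <- s) f i x)).
Proof.
move=> intf; apply: eq_integrable (integrable_sum _ _ (fun i _ => intf i)) => //.
by move=> x _; rewrite /= sumEFin.
Qed.

Lemma Rintegral_sum (I : Type) (s : seq I) (f : I -> T -> R) :
  (forall i, mu.-integrable setT (EFin \o f i)) ->
  \int[mu]_x (\sum_(i <- s) f i x) = \sum_(i <- s) \int[mu]_x f i x.
Proof.
move=> intf; elim: s => [|i s ih].
  rewrite big_nil (@eq_Rintegral _ _ _ mu setT (cst 0)) => [|x _]; last first.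
    by rewrite big_nil.
  by rewrite Rintegral_cst// mul0r.
rewrite big_cons -ih -RintegralD//; last exact: integrableT_sum.
by apply: eq_Rintegral => x _; rewrite big_cons.
Qed.

Lemma integrableTZ (k : R) (f : T -> R) : mu.-integrable setT (EFin \o f) ->
  mu.-integrable setT (EFin \o (fun x => k * f x)).
Proof.
by move=> intf; apply: eq_integrable (integrableZl measurableT k intf).
Qed.

Definition mom1 n (w : T -> 'cV[R]_n) : 'cV[R]_n := \col_i \int[mu]_z w z i 0.

Definition mom2 n (w : T -> 'cV[R]_n) : 'M[R]_n :=
  \matrix_(i, j) \int[mu]_z (w z i 0 * w z j 0).

(** Keeping [w] a vector-valued function on an arbitrary space lets one theory serve the state, the
    control, the pair, the mean [A x + B u], and the identity under a law on the state space. *)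
Definition square_integrable n (w : T -> 'cV[R]_n) : Prop :=
  (forall i, measurable_fun setT (fun z => w z i 0)) /\
  mu.-integrable setT (EFin \o (fun z => normsq (w z))).

Section linear_maps.
Variables (n : nat) (w : T -> 'cV[R]_n).
Hypothesis w2 : square_integrable w.

Lemma integrable_coordM i j :
  mu.-integrable setT (EFin \o (fun z => w z i 0 * w z j 0)).
Proof.
have [mw iw] := w2; apply: le_integrable iw => //.
  by apply/measurable_EFinP; apply: measurable_funM.
move=> z _ /=; rewrite lee_fin.
(* Each square is bounded separately: with [a^2 <= c] and [b^2 <= c], the bound
   [|a b| <= (a^2 + b^2) / 2 <= c] also covers [i = j]. *)
have le_sqr k : w z k 0 ^+ 2 <= normsq (w z).
  by rewrite /normsq (bigD1 k)//= lerDl sumr_ge0// => l _; exact: sqr_ge0.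
have := le_sqr i; have := le_sqr j.
set a := w z i 0; set b := w z j 0; set c := normsq _ => hb ha.
have c0 : 0 <= c by apply: le_trans ha; exact: sqr_ge0.
rewrite (ger0_norm c0) ler_norml; apply/andP; split; nra.
Qed.

Lemma square_integrable_mulmx m (M : 'M[R]_(m, n)) :
  square_integrable (fun z => M *m w z).
Proof.
have [mw iw] := w2; split.
  move=> i; under eq_fun do rewrite mxE.
  by apply: measurable_sum => k; apply: measurable_funM.
rewrite /normsq; apply: integrableT_sum => i.
apply: eq_integrable (_ : mu.-integrable setT (EFin \o (fun z =>
    \sum_k \sum_l (M i k * M i l) * (w z k 0 * w z l 0)))) => //.
  move=> z _ /=; rewrite mxE expr2 mulr_suml; congr EFin.
  apply: eq_bigr => k _; rewrite mulr_sumr; apply: eq_bigr => l _; ring.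
do 2!apply: integrableT_sum => ?.
by apply: integrableTZ; exact: integrable_coordM.
Qed.

(** Used with [M] a row [c^T], to get quadratic forms, and with [M = row_mx A B], to push [(x, u)]
    through the dynamics. *)
Lemma mom2_mulmx m (M : 'M[R]_(m, n)) :
  mom2 (fun z => M *m w z) = M *m mom2 w *m M^T.
Proof.
apply/matrixP => i j; rewrite mxE.
transitivity (\int[mu]_z
    (\sum_k \sum_l (M i k * M j l) * (w z k 0 * w z l 0))).
  apply: eq_Rintegral => z _; rewrite !mxE mulr_suml; apply: eq_bigr => k _.
  by rewrite mulr_sumr; apply: eq_bigr => l _; ring.
have iS k l : mu.-integrable setT
    (EFin \o (fun z => (M i k * M j l) * (w z k 0 * w z l 0))).
  by apply: integrableTZ; exact: integrable_coordM.
rewrite Rintegral_sum => [|k]; last exact: integrableT_sum.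
rewrite mxE.
under [RHS]eq_bigr do rewrite mxE mulr_suml.
rewrite exchange_big; apply: eq_bigr => k _ /=.
rewrite Rintegral_sum//; apply: eq_bigr => l _.
rewrite RintegralZl//; last exact: integrable_coordM.
by rewrite !mxE; ring.
Qed.

Lemma integrable_quad (P : 'M[R]_n) :
  mu.-integrable setT (EFin \o (fun z => ((w z)^T *m P *m w z) 0 0)).
Proof.
under [X in EFin \o X]eq_fun do rewrite quad_formE.
do 2!apply: integrableT_sum => ?.
by apply: integrableTZ; exact: integrable_coordM.
Qed.

Lemma Rintegral_quad (P : 'M[R]_n) :
  \int[mu]_z ((w z)^T *m P *m w z) 0 0 = \tr (P *m mom2 w).
Proof.
under eq_Rintegral do rewrite quad_formE.
have iS k l : mu.-integrable setT
    (EFin \o (fun z => P k l * (w z k 0 * w z l 0))).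
  by apply: integrableTZ; exact: integrable_coordM.
rewrite Rintegral_sum => [|k]; last exact: integrableT_sum.
rewrite /mxtrace; apply: eq_bigr => k _.
rewrite Rintegral_sum// mxE; apply: eq_bigr => l _.
rewrite RintegralZl//; last exact: integrable_coordM.
rewrite mxE; congr (_ * _); apply: eq_Rintegral => z _; exact: mulrC.
Qed.

Lemma mom2_sym : (mom2 w)^T = mom2 w.
Proof.
by apply/matrixP => i j; rewrite !mxE; apply: eq_Rintegral => z _; exact: mulrC.
Qed.

Hypothesis fin_mu : (mu setT < +oo)%E.

Lemma integrableT_cst (r : R) : mu.-integrable setT (EFin \o (fun=> r)).
Proof.
apply: measurable_bounded_integrable => //.
exists `|r|; split; first exact: num_real.
by move=> M rM z _ /=; exact: ltW.
Qed.

Lemma integrable_coord i : mu.-integrable setT (EFin \o (fun z => w z i 0)).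
Proof.
have [mw iw] := w2.
apply: le_integrable (integrableD measurableT
  (integrableT_cst 1) (integrable_coordM i i)) => //.
  exact/measurable_EFinP.
move=> z _ /=; rewrite lee_fin; set a := w z i 0.
by rewrite (ger0_norm (_ : 0 <= 1 + a * a)) ?ler_norml; [apply/andP; split|]; nra.
Qed.

Lemma mom1_mulmx m (M : 'M[R]_(m, n)) :
  mom1 (fun z => M *m w z) = M *m mom1 w.
Proof.
apply/matrixP => i j; rewrite !mxE.
under eq_Rintegral do rewrite mxE.
rewrite Rintegral_sum => [|k]; last exact/integrableTZ/integrable_coord.
by apply: eq_bigr => k _; rewrite RintegralZl ?mxE//; exact: integrable_coord.
Qed.

Lemma integrable_dot (q : 'cV[R]_n) :
  mu.-integrable setT (EFin \o (fun z => (q^T *m w z) 0 0)).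
Proof.
under [X in EFin \o X]eq_fun do rewrite dotE.
apply: integrableT_sum => i; exact/integrableTZ/integrable_coord.
Qed.

Lemma Rintegral_dot (q : 'cV[R]_n) :
  \int[mu]_z (q^T *m w z) 0 0 = (q^T *m mom1 w) 0 0.
Proof. by rewrite -mom1_mulmx mxE. Qed.

End linear_maps.

Lemma Rintegral_normsq n (w : T -> 'cV[R]_n) : square_integrable w ->
  \int[mu]_z normsq (w z) = \tr (mom2 w).
Proof.
move=> w2; rewrite Rintegral_sum => [|i].
  by apply: eq_bigr => i _; rewrite mxE.
exact: integrable_coordM.
Qed.

Definition cross_mom n m (w1 : T -> 'cV[R]_n) (w2 : T -> 'cV[R]_m) : 'M[R]_(n, m) :=
  \matrix_(i, j) \int[mu]_z (w1 z i 0 * w2 z j 0).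

Lemma mom1_col_mx n m (w1 : T -> 'cV[R]_n) (w2 : T -> 'cV[R]_m) :
  mom1 (fun z => col_mx (w1 z) (w2 z)) = col_mx (mom1 w1) (mom1 w2).
Proof.
rewrite -[LHS]vsubmxK; congr col_mx; apply/matrixP => i j; rewrite !mxE;
  by apply: eq_Rintegral => z _; rewrite ?col_mxEu ?col_mxEd.
Qed.

(** Applied to [(x, u)] for the dynamics, and again to [(1, (x, u))], where the blocks are those of
    the matrix in (Cp). *)
Lemma mom2_col_mx n m (w1 : T -> 'cV[R]_n) (w2 : T -> 'cV[R]_m) :
  mom2 (fun z => col_mx (w1 z) (w2 z)) =
  block_mx (mom2 w1) (cross_mom w1 w2) (cross_mom w1 w2)^T (mom2 w2).
Proof.
rewrite -[LHS]submxK; congr block_mx; apply/matrixP => i j; rewrite !mxE;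
  apply: eq_Rintegral => z _; rewrite ?col_mxEu ?col_mxEd//; exact: mulrC.
Qed.

Lemma normsq_col_mx n m (x : 'cV[R]_n) (u : 'cV[R]_m) :
  normsq (col_mx x u) = normsq x + normsq u.
Proof.
rewrite /normsq big_split_ord /=; congr (_ + _).
  by apply: eq_bigr => i _; rewrite col_mxEu.
by apply: eq_bigr => i _; rewrite col_mxEd.
Qed.

Lemma square_integrable_col_mx n m (w1 : T -> 'cV[R]_n) (w2 : T -> 'cV[R]_m) :
  square_integrable w1 -> square_integrable w2 ->
  square_integrable (fun z => col_mx (w1 z) (w2 z)).
Proof.
move=> [mw1 iw1] [mw2 iw2]; split.
  move=> i; rewrite -(splitK i); case: (fintype.split i) => k /=.
    by under eq_fun do rewrite col_mxEu; exact: mw1.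
  by under eq_fun do rewrite col_mxEd; exact: mw2.
apply: eq_integrable (integrableD measurableT iw1 iw2) => // z _.
by rewrite /= normsq_col_mx.
Qed.

(** The quadratic form at [x] is the second moment of the scalar [x^T w], the integral of a
    square. *)
Lemma mom2_psd n (w : T -> 'cV[R]_n) : square_integrable w -> is_psd (mom2 w).
Proof.
move=> w2; split; first exact: mom2_sym.
move=> x; have := mom2_mulmx w2 x^T; rewrite trmxK => <-.
by rewrite mxE; apply: Rintegral_ge0 => z _; rewrite -expr2 sqr_ge0.
Qed.

End moment_vectors.

Section centered_moments.
Context d (T : measurableType d) (R : realType).
Variable P : {measure set T -> \bar R}.
Hypothesis P1 : P setT = 1%E.
Variables (n : nat) (w : T -> 'cV[R]_n).
Hypothesis w2 : square_integrable P w.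

Let finP : (P setT < +oo)%E. Proof. by rewrite P1 ltry. Qed.

(** Lets the term [Sigma0 + m0 m0^T] of (C2) be read as the raw second moment of [nu0]. *)
Lemma mom2_centered :
  (\matrix_(i, j) \int[P]_z ((w z i 0 - mom1 P w i 0) * (w z j 0 - mom1 P w j 0)))
    + mom1 P w *m (mom1 P w)^T = mom2 P w.
Proof.
apply/matrixP => i j; rewrite mxE [X in X + _]mxE [X in _ + X]mxE big_ord1.
rewrite [X in _ * X]mxE [RHS]mxE.
set b := mom1 P w i 0; set c := mom1 P w j 0.
have bE : \int[P]_z w z i 0 = b by rewrite /b mxE.
have cE : \int[P]_z w z j 0 = c by rewrite /c mxE.
have ii k := integrable_coord w2 finP k.
have iM := integrable_coordM w2 i j.
rewrite (@eq_Rintegral _ _ _ P setT (fun z => w z i 0 * w z j 0 +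
  (- c * w z i 0 + (- b * w z j 0 + b * c)))); last first.
  by move=> z _; ring.
have icst := integrableT_cst finP (b * c).
have i1 := integrableTZ (- c) (ii i).
have i2 := integrableTZ (- b) (ii j).
have i3 := integrableD measurableT i2 icst.
have i4 := integrableD measurableT i1 i3.
rewrite RintegralD// RintegralD// RintegralD// Rintegral_cst// P1 !RintegralZl//.
by rewrite bE cE /=; ring.
Qed.

End centered_moments.

(** Polarization: evaluate at [e_i], [e_j] and [e_i + e_j]. Symmetry merges the entries [(i, j)] and
    [(j, i)], which a quadratic form sees only through their sum. *)
Lemma quad_form_inj {R : realType} n (S1 S2 : 'M[R]_n) :
  S1^T = S1 -> S2^T = S2 ->
  (forall c : 'cV[R]_n, (c^T *m S1 *m c) 0 0 = (c^T *m S2 *m c) 0 0) -> S1 = S2.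
Proof.
move=> sS1 sS2 h; apply/matrixP => i j.
have bil (S : 'M[R]_n) k l : ((delta_mx k 0 : 'cV[R]_n)^T *m S *m
    (delta_mx l 0 : 'cV[R]_n)) 0 0 = S k l.
  by rewrite trmx_delta -rowE -colE !mxE.
have := h (delta_mx i 0 + delta_mx j 0).
have := h (delta_mx i 0); have := h (delta_mx j 0).
rewrite !bil [(_ + _)^T]linearD/= !mulmxDl !mulmxDr.
have e (S : 'M[R]_n) k l : ((delta_mx k 0 : 'cV[R]_n)^T *m S *m
    (delta_mx l 0 : 'cV[R]_n)) = (S k l)%:M.
  by rewrite [LHS]mx11_scalar bil.
rewrite !e !mxE !mulr1n.
have -> : S1 j i = S1 i j by rewrite -[in LHS]sS1 mxE.
have -> : S2 j i = S2 i j by rewrite -[in LHS]sS2 mxE.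
by move=> h1 h2 h3; lra.
Qed.

(** * Moments of a possibly degenerate Gaussian vector *)

Section gaussian_moments.
Context (R : realType) (n : nat).
Variables (a : 'cV[R]_n) (W : 'M[R]_n).
Hypothesis hW : is_psd W.
Variable P : {measure set 'cV[R]_n -> \bar R}.
Hypothesis P1 : P setT = 1%E.
Hypothesis gP : is_gaussian a W P.

Let finP : (P setT < +oo)%E. Proof. by rewrite P1 ltry. Qed.

Section projection.
Variable c : 'cV[R]_n.
Let phi (y : 'cV[R]_n) : R := (c^T *m y) 0 0.
Let v := (c^T *m W *m c) 0 0.

Let mphi : measurable_fun setT phi.
Proof.
rewrite /phi; under eq_fun do rewrite mxE.
by apply: measurable_sum => i; apply: measurable_funM => //; exact: measurable_coord.
Qed.

Let v0 : 0 <= v. Proof. by case: hW => _; exact. Qed.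

(** The pushforward of [P] by [phi] is the scalar law given by [is_gaussian]; for zero variance it
    is the Dirac mass at [phi a]. *)
Let integral_phi (f : R -> R) : (forall x, 0 <= f x) -> measurable_fun setT f ->
  (\int[P]_y (f (phi y))%:E = if v == 0%R then (f (phi a))%:E else
    \int[normal_prob (phi a) (Num.sqrt v)]_x (f x)%:E)%E.
Proof.
move=> f0 mf.
have := @ge0_integral_pushforward _ _ _ (measurableTypeR R) R phi mphi P setT
  (EFin \o f) measurableT.
rewrite preimage_setT => <-; first last.
- by move=> y _; rewrite lee_fin.
- exact/measurable_EFinP.
have PE U : measurable U -> pushforward P phi U = gauss1 (phi a) v U.
  exact: gP.
case: ifPn => v_eq0.
  rewrite (eq_measure_integral (dirac (phi a : measurableTypeR R))); last first.
    by move=> U mU _; apply: (etrans (PE U mU)); rewrite /gauss1 v_eq0.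
  by rewrite integral_dirac// ?diracT ?mul1e//; exact/measurable_EFinP.
rewrite [LHS](eq_measure_integral (normal_prob (phi a) (Num.sqrt v)))//.
by move=> U mU _; apply: (etrans (PE U mU)); rewrite /gauss1 (negbTE v_eq0).
Qed.

Let sqrtv0 : v != 0 -> 0 < Num.sqrt v.
Proof. by move=> vn0; rewrite sqrtr_gt0 lt_neqAle eq_sym vn0. Qed.

Let mB : measurable_fun setT (fun x : R => x - phi a).
Proof. exact: measurable_funB. Qed.

Lemma gaussian_projection_variance :
  (\int[P]_y ((phi y - phi a) ^+ 2)%:E = v%:E)%E.
Proof.
rewrite (integral_phi (f := fun x => (x - phi a) ^+ 2)); last 2 first.
- by move=> x; exact: sqr_ge0.
- exact: measurable_funX.
have [->|vn0] := eqVneq; first by rewrite subrr expr0n.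
by rewrite normal_prob_variance ?sqrtv0// sqr_sqrtr.
Qed.

Lemma integrable_gaussian_projection_sqr :
  P.-integrable setT (EFin \o (fun y => (phi y - phi a) ^+ 2)).
Proof.
apply/integrableP; split.
  by apply/measurable_EFinP; apply: measurable_funX; exact: measurable_funB.
under eq_integral do rewrite /= ger0_norm ?sqr_ge0//.
by rewrite gaussian_projection_variance ltry.
Qed.

Lemma integrable_gaussian_projection :
  P.-integrable setT (EFin \o (fun y => phi y - phi a)).
Proof.
apply: le_integrable (integrableD measurableT
  (integrableT_cst finP 1) integrable_gaussian_projection_sqr) => //.
  by apply/measurable_EFinP; exact: measurable_funB.
move=> y _ /=; rewrite lee_fin; set x := phi y - phi a.
by rewrite (ger0_norm (_ : 0 <= 1 + x ^+ 2)) ?ler_norml; [apply/andP; split|]; nra.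
Qed.

Lemma gaussian_projection_mean : \int[P]_y (phi y - phi a) = 0.
Proof.
have i1 := integrable_gaussian_projection.
have mm (h : R -> R) : measurable_fun setT h ->
    measurable_fun setT (fun x => Num.max (h x) 0).
  by move=> mh; exact: measurable_maxr.
(* With [s = 1] and [s = -1] this covers both the positive and the negative part. *)
have im (s : R) : `|s| = 1 ->
    P.-integrable setT (EFin \o (fun y => Num.max (s * (phi y - phi a)) 0)).
  move=> s1; apply: le_integrable i1 => //.
    apply/measurable_EFinP; apply: measurable_maxr => //.
    by apply: measurable_funM => //; exact: measurable_funB.
  move=> y _ /=; rewrite lee_fin; set x := phi y - phi a.
  rewrite ger0_norm ?le_max ?lexx ?orbT// ge_max normr_ge0 andbT.
  by rewrite -[leRHS]mul1r -s1 -normrM ler_norm.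
transitivity (\int[P]_y (Num.max (1 * (phi y - phi a)) 0 -
                         Num.max (-1 * (phi y - phi a)) 0)).
  apply: eq_Rintegral => y _; rewrite mul1r mulN1r; set x := phi y - phi a.
  have [x0|x0] := leP 0 x.
    by rewrite max_r ?subr0// oppr_le0.
  by rewrite max_l ?sub0r ?opprK// oppr_ge0 ltW.
rewrite RintegralB ?im ?normr1 ?normrN1//.
apply/eqP; rewrite subr_eq0; apply/eqP; congr fine.
under eq_integral do rewrite mul1r.
under [RHS]eq_integral do rewrite mulN1r.
rewrite (integral_phi (f := fun x => Num.max (x - phi a) 0)); last 2 first.
- by move=> x; rewrite le_max lexx orbT.
- exact: mm.
rewrite (integral_phi (f := fun x => Num.max (- (x - phi a)) 0)); last 2 first.
- by move=> x; rewrite le_max lexx orbT.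
- by apply: mm; exact: measurableT_comp.
case: ifPn => [_|vn0]; first by rewrite subrr oppr0.
by rewrite normal_prob_centered_parts ?sqrtv0.
Qed.

End projection.

Lemma square_integrable_gaussian : square_integrable P id.
Proof.
split; first by move=> i; exact: measurable_coord.
rewrite /normsq; apply: integrableT_sum => i.
have h := integrable_gaussian_projection_sqr (delta_mx i 0).
have cE (y : 'cV[R]_n) : ((delta_mx i 0 : 'cV[R]_n)^T *m y) 0 0 = y i 0.
  by rewrite trmx_delta -rowE mxE.
apply: le_integrable (integrableD measurableT
  (integrableTZ 2 h) (integrableT_cst finP (2 * a i 0 ^+ 2))) => //.
  by apply/measurable_EFinP; apply: measurable_funX; exact: measurable_coord.
move=> y _ /=; rewrite !cE lee_fin.
set x := y i 0; set b := a i 0.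
have h0 : 0 <= 2 * (x - b) ^+ 2 + 2 * b ^+ 2.
  by rewrite addr_ge0// mulr_ge0// sqr_ge0.
rewrite (ger0_norm h0) (ger0_norm (sqr_ge0 x)).
(* [2 (x - b)^2 + 2 b^2 - x^2] is exactly [(x - 2 b)^2]. *)
by have := sqr_ge0 (x - 2 * b); nra.
Qed.

Lemma mom1_gaussian : mom1 P id = a.
Proof.
apply/matrixP => i j; rewrite ord1 !mxE.
have h := gaussian_projection_mean (delta_mx i 0).
have cE (y : 'cV[R]_n) : ((delta_mx i 0 : 'cV[R]_n)^T *m y) 0 0 = y i 0.
  by rewrite trmx_delta -rowE mxE.
have := integrable_coord square_integrable_gaussian finP i => /= ii.
have ia := integrableT_cst finP (a i 0).
move: h; under eq_Rintegral do rewrite !cE.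
rewrite RintegralB// Rintegral_cst// P1 mulr1.
by move=> /eqP; rewrite subr_eq0 => /eqP.
Qed.

Lemma mom2_gaussian : mom2 P id = W + a *m a^T.
Proof.
have w2 := square_integrable_gaussian.
apply: quad_form_inj => [||c]; first exact: mom2_sym.
  by case: hW => sW _; rewrite linearD/= trmx_mul trmxK sW.
have := mom2_mulmx w2 c^T; rewrite trmxK => <-.
rewrite mxE mulmxDr mulmxDl mxE !mulmxA.
rewrite -(mulmxA (c^T *m a)) [X in _ + X]mxE big_ord1.
have -> : (a^T *m c) 0 0 = (c^T *m a) 0 0.
  by rewrite -[in RHS](trmxK a) -trmx_mul [RHS]mxE.
set b := (c^T *m a) 0 0.
have i2 := integrable_gaussian_projection_sqr c.
have i1 := integrableTZ (2 * b) (integrable_gaussian_projection c).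
have i0 := integrableT_cst finP (b ^+ 2).
have i01 := integrableD measurableT i1 i0.
(* Expansion about the mean [b] of the projection: the square integrates to [c^T W c], the linear
   term to 0. *)
rewrite (@eq_Rintegral _ _ _ P setT (fun y => ((c^T *m y) 0 0 - b) ^+ 2 +
  (2 * b * ((c^T *m y) 0 0 - b) + b ^+ 2))); last by move=> y _; ring.
rewrite RintegralD// RintegralD// Rintegral_cst// P1.
rewrite RintegralZl//; last exact: integrable_gaussian_projection.
rewrite gaussian_projection_mean /Rintegral gaussian_projection_variance /=.
by ring.
Qed.

End gaussian_moments.

(** * Integration against a difference of measures *)

Section integral_scale_add.
Context d (T : measurableType d) (R : realType).
Local Open Scope ereal_scope.

Lemma integral_mscale (k : {nonneg R}) (mu : {measure set T -> \bar R})
    (f : T -> \bar R) : mu.-integrable setT f ->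
  \int[mscale k mu]_x f x = k%:num%:E * \int[mu]_x f x.
Proof.
move=> fi; have mf := measurable_int _ fi.
have mfp : measurable_fun setT f^\+ by exact: measurable_funepos.
have mfn : measurable_fun setT f^\- by exact: measurable_funeneg.
have -> : \int[mu]_x f x = \int[mu]_x f^\+ x - \int[mu]_x f^\- x.
  by rewrite integralE.
rewrite [LHS]integralE (ge0_integral_mscale _ _ _ mfp)//.
rewrite (ge0_integral_mscale _ _ _ mfn)//.
by rewrite [RHS](muleBr _ (integrable_add_def measurableT fi)).
Qed.

Lemma integrable_mscale (k : {nonneg R}) (mu : {measure set T -> \bar R})
    (f : T -> \bar R) : mu.-integrable setT f -> (mscale k mu).-integrable setT f.
Proof.
move=> /integrableP[mf fi]; apply/integrableP; split => //.
rewrite ge0_integral_mscale//; last exact: measurableT_comp.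
by apply: lte_mul_pinfty => //; rewrite lee_fin.
Qed.

Lemma integrable_measure_add (m1 m2 : {measure set T -> \bar R})
    (f : T -> \bar R) : m1.-integrable setT f -> m2.-integrable setT f ->
  (measure_add m1 m2).-integrable setT f.
Proof.
move=> /integrableP[mf fi1] /integrableP[_ fi2]; apply/integrableP; split => //.
rewrite ge0_integral_measure_add//; last exact: measurableT_comp.
exact: lte_add_pinfty.
Qed.

End integral_scale_add.

Section charge_difference.
Context d (T : measurableType d) (R : realType).
Variables (nu : {charge set T -> \bar R}) (p q : {measure set T -> \bar R}).
Hypotheses (finp : (p setT < +oo)%E) (finq : (q setT < +oo)%E).
Hypothesis nuE : forall E : set T, measurable E -> nu E = (p E - q E)%E.
Local Open Scope ereal_scope.

Let fin (l : {measure set T -> \bar R}) E : l setT < +oo -> measurable E ->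
  l E \is a fin_num.
Proof.
move=> lfin mE; rewrite ge0_fin_numE//; apply: le_lt_trans lfin.
by apply: le_measure; rewrite ?inE.
Qed.

(** Minimality of the Jordan decomposition: [cpos nu E] is [nu] on the part of [E] in the positive
    Hahn set, where [p - q <= p]. *)
Let cpos_le E : measurable E -> cpos nu E <= p E.
Proof.
move=> mE; have -> : cpos nu E = nu (E `&` (hahn_pair nu).1).
  by apply: (etrans (jordan_posE _ _)); rewrite /= /crestr0 mem_set.
have mP : measurable (hahn_pair nu).1 by case: (hahnP nu) => -[].
have mEP : measurable (E `&` (hahn_pair nu).1) by exact: measurableI.
rewrite nuE//; apply: (@le_trans _ _ (p (E `&` (hahn_pair nu).1))).
  by rewrite leeBlDr ?fin// leeDl.
by apply: le_measure; rewrite ?inE//; exact: subIsetl.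
Qed.

Let cneg_le E : measurable E -> cneg nu E <= q E.
Proof.
move=> mE; have -> : cneg nu E = - nu (E `&` (hahn_pair nu).2).
  by apply: (etrans (jordan_negE _ _)); rewrite cjordan_negE /crestr0 mem_set.
have mN : measurable (hahn_pair nu).2 by case: (hahnP nu) => _ [].
have mEN : measurable (E `&` (hahn_pair nu).2) by exact: measurableI.
rewrite nuE// fin_num_oppeB ?fin//.
apply: (@le_trans _ _ (q (E `&` (hahn_pair nu).2))).
  by rewrite addeC leeBlDr ?fin// leeDl.
by apply: le_measure; rewrite ?inE//; exact: subIsetl.
Qed.

Let integrable_le (l1 l2 : {measure set T -> \bar R}) (f : T -> \bar R) :
  (forall E, measurable E -> l1 E <= l2 E) ->
  l2.-integrable setT f -> l1.-integrable setT f.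
Proof.
move=> l12 /integrableP[mf fi]; apply/integrableP; split => //.
apply: le_lt_trans fi; apply: ge0_le_measure_integral => //.
exact: measurableT_comp.
Qed.

(** Measures can be added but not subtracted, so [cpos - cneg = p - q] is rearranged into an
    equality of two sums of measures before integrating. Domination by [p] and [q] makes all four
    integrals finite, and the terms can be moved back. *)
Lemma cint_difference (f : T -> \bar R) :
  p.-integrable setT f -> q.-integrable setT f ->
  cint nu f = \int[p]_x f x - \int[q]_x f x.
Proof.
move=> fp fq; have mf := measurable_int _ fp.
have fcp := integrable_le cpos_le fp; have fcn := integrable_le cneg_le fq.
have : \int[measure_add (cpos nu) q]_x f x = \int[measure_add (cneg nu) p]_x f x.
  apply: eq_measure_integral => E mE _.
  suff h : cpos nu E + q E = cneg nu E + p E.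
    by rewrite [LHS]measure_addE h; apply/esym; exact: measure_addE.
  have := jordan_decomp (hahnP nu) mE.
  rewrite nuE//= /cadd/= cscaleN1/= -/(cpos nu) -/(cneg nu).
  have := @fin_num_measure _ _ _ (cpos nu) E mE.
  have := @fin_num_measure _ _ _ (cneg nu) E mE.
  have := fin finp mE; have := fin finq mE.
  move: (p E) (q E) (cneg nu E) (cpos nu E) => [a| |]// [b| |]// [c| |]// [e| |]//.
  by move=> _ _ _ _ [h]; rewrite -!EFinD; congr EFin; lra.
rewrite !integral_measure_add// /cint.
have := integrable_fin_num measurableT fp.
have := integrable_fin_num measurableT fq.
have := integrable_fin_num measurableT fcp.
have := integrable_fin_num measurableT fcn.
move: (integral p _ f) (integral q _ f) (integral (cpos nu) _ f)
  (integral (cneg nu) _ f) => [a| |]// [b| |]// [c| |]// [e| |]//.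
by move=> _ _ _ _ [h]; rewrite -!EFinB; congr EFin; lra.
Qed.

End charge_difference.

Lemma cint_finite_measure d (T : measurableType d) (R : realType)
    (mu : {finite_measure set T -> \bar R}) (f : T -> \bar R) :
  mu.-integrable setT f ->
  cint (charge_of_finite_measure mu) f = (\int[mu]_x f x)%E.
Proof.
move=> fi; rewrite (@cint_difference _ _ _ _ mu mzero)//.
- by rewrite integral_measure_zero sube0.
- by rewrite ltey_eq fin_num_measure.
- by rewrite /mzero ltry.
- by move=> E mE; rewrite /mzero sube0.
- apply/integrableP; split; first exact: (measurable_int _ fi).
  by rewrite integral_measure_zero.
Qed.

Lemma integrable_quadratic_growth {R : realType} n
    (nu : {measure set 'cV[R]_n -> \bar R}) (v : 'cV[R]_n -> R) :
  (nu setT < +oo)%E -> square_integrable nu id -> in_F v ->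
  nu.-integrable setT (EFin \o v).
Proof.
move=> nufin [_ nu2] [mv [K vK]].
(* The absolute value makes the dominating function visibly nonnegative. *)
apply: le_integrable (integrableTZ `|K| (integrableD measurableT
  (integrableT_cst nufin 1) nu2)) => //; first exact/measurable_EFinP.
move=> x _ /=; rewrite lee_fin.
have x0 : 0 <= 1 + normsq x.
  by rewrite addr_ge0// sumr_ge0// => i _; exact: sqr_ge0.
rewrite (ger0_norm (mulr_ge0 (normr_ge0 K) x0)).
by apply: le_trans (vK x) _; rewrite ler_wpM2r// ler_norm.
Qed.

Section quadratic_functions.
Context d (T : measurableType d) (R : realType).
Variable mu : {measure set T -> \bar R}.
Hypothesis mufin : (mu setT < +oo)%E.
Variables (n : nat) (w : T -> 'cV[R]_n).
Hypothesis w2 : square_integrable mu w.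
Variables (P : 'M[R]_n) (q : 'cV[R]_n) (r : R).

Lemma Rintegral_quadratic :
  \int[mu]_z (((w z)^T *m P *m w z) 0 0 + (q^T *m w z) 0 0 + r) =
  \tr (P *m mom2 mu w) + (q^T *m mom1 mu w) 0 0 + r * fine (mu setT).
Proof.
have iP := integrable_quad w2 P.
have iq := integrable_dot w2 mufin q.
have ir := integrableT_cst mufin r.
have iPq := integrableD measurableT iP iq.
by rewrite RintegralD// RintegralD// Rintegral_quad// Rintegral_dot// Rintegral_cst.
Qed.

End quadratic_functions.

Lemma in_F_quadratic {R : realType} n (v : 'cV[R]_n -> R) : in_Fhat v -> in_F v.
Proof.
move=> [P [q [r [sP ->]]]]; split.
  under eq_fun do rewrite quad_formE dotE.
  apply: measurable_funD => //; apply: measurable_funD.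
    do 2!apply: measurable_sum => ?.
    by do 2!apply: measurable_funM => //; exact: measurable_coord.
  by apply: measurable_sum => i; apply: measurable_funM => //; exact: measurable_coord.
(* Each monomial [x_i x_j], [x_i] or [1] is at most [1 + normsq x] in absolute value, so the sum of
   the absolute coefficients is a valid constant. *)
exists (\sum_i \sum_j `|P i j| + \sum_i `|q i 0| + `|r|) => x.
have x0 : 0 <= normsq x by rewrite sumr_ge0// => i _; exact: sqr_ge0.
have le_sqr k : x k 0 ^+ 2 <= normsq x.
  by rewrite /normsq (bigD1 k)//= lerDl sumr_ge0// => l _; exact: sqr_ge0.
have x1 : 0 <= 1 + normsq x by rewrite addr_ge0.
rewrite !mulrDl; apply: le_trans (ler_normD _ _) _; apply: lerD; last first.
  by rewrite ler_peMr// lerDl.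
apply: le_trans (ler_normD _ _) _; apply: lerD.
  rewrite quad_formE mulr_suml; apply: le_trans (ler_norm_sum _ _ _) _.
  apply: ler_sum => i _; rewrite mulr_suml.
  apply: le_trans (ler_norm_sum _ _ _) _; apply: ler_sum => j _.
  rewrite normrM ler_wpM2l// ler_norml; have := le_sqr i; have := le_sqr j.
  by move: (x i 0) (x j 0) (normsq x) => a b c ha hb; apply/andP; split; nra.
rewrite dotE mulr_suml; apply: le_trans (ler_norm_sum _ _ _) _.
apply: ler_sum => i _; rewrite normrM ler_wpM2l// ler_norml; have := le_sqr i.
by move: (x i 0) (normsq x) => a c ha; apply/andP; split; nra.
Qed.

(** * Moments of the state after one controlled step *)

Section controlled_kernel.
Context (R : realType) (n m : nat).
Variables (A : 'M[R]_n) (B : 'M[R]_(n, m)) (W : 'M[R]_n).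
Variable tau : R.-pker ('cV[R]_n * 'cV[R]_m)%type ~> 'cV[R]_n.
Hypothesis htau : forall x u, is_gaussian (A *m x + B *m u) W (tau (x, u)).
Hypothesis hW : is_psd W.
Variable mu : {finite_measure set ('cV[R]_n * 'cV[R]_m)%type -> \bar R}.
Hypothesis hmu : in_Mplus mu.

Let mufin : (mu setT < +oo)%E.
Proof. by rewrite ltey_eq fin_num_measure. Qed.

Lemma square_integrable_state : square_integrable mu (fun z => z.1).
Proof.
have m1 i : measurable_fun setT (fun z : 'cV[R]_n * 'cV[R]_m => z.1 i 0).
  exact: measurableT_comp (measurable_coord i 0) measurable_fst.
split => //; apply: le_integrable hmu => //.
  apply/measurable_EFinP; apply: measurable_sum => i; exact: measurable_funX.
move=> z _ /=; rewrite lee_fin !ger0_norm ?addr_ge0 ?sumr_ge0//;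
  try by move=> *; exact: sqr_ge0.
by rewrite lerDl sumr_ge0// => *; exact: sqr_ge0.
Qed.

Lemma square_integrable_control : square_integrable mu (fun z => z.2).
Proof.
have m2 i : measurable_fun setT (fun z : 'cV[R]_n * 'cV[R]_m => z.2 i 0).
  exact: measurableT_comp (measurable_coord i 0) measurable_snd.
split => //; apply: le_integrable hmu => //.
  apply/measurable_EFinP; apply: measurable_sum => i; exact: measurable_funX.
move=> z _ /=; rewrite lee_fin !ger0_norm ?addr_ge0 ?sumr_ge0//;
  try by move=> *; exact: sqr_ge0.
by rewrite lerDr sumr_ge0// => *; exact: sqr_ge0.
Qed.

Let next_mean (z : 'cV[R]_n * 'cV[R]_m) := A *m z.1 + B *m z.2.

(** As a single linear image of [(x, u)], the mean gets its moments from the block formulas, cross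
    terms included. *)
Let next_meanE z : next_mean z = row_mx A B *m col_mx z.1 z.2.
Proof. by rewrite mul_row_col. Qed.

Let sq_xu := square_integrable_col_mx square_integrable_state
  square_integrable_control.

Let square_integrable_next_mean : square_integrable mu next_mean.
Proof.
rewrite (_ : next_mean = fun z => row_mx A B *m col_mx z.1 z.2).
  exact: square_integrable_mulmx sq_xu _ _.
by apply/funext => z; exact: next_meanE.
Qed.

Let mom1_next_mean :
  mom1 mu next_mean = A *m v_mx (moments mu) + B *m v_mu (moments mu).
Proof.
rewrite (_ : next_mean = fun z => row_mx A B *m col_mx z.1 z.2).
  by rewrite mom1_mulmx// mom1_col_mx mul_row_col.
by apply/funext => z; exact: next_meanE.
Qed.

Let mom2_next_mean : mom2 mu next_mean =
  A *m v_Zxx (moments mu) *m A^T + A *m v_Zxu (moments mu) *m B^T +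
  B *m (v_Zxu (moments mu))^T *m A^T + B *m v_Zuu (moments mu) *m B^T.
Proof.
rewrite (_ : next_mean = fun z => row_mx A B *m col_mx z.1 z.2).
  rewrite mom2_mulmx// mom2_col_mx mul_row_block tr_row_mx mul_row_col.
  rewrite !mulmxDl -!addrA; congr (_ + _); rewrite addrCA; congr (_ + _).
by apply/funext => z; exact: next_meanE.
Qed.

Let tau1 z : tau z setT = 1%E. Proof. exact: prob_kernel. Qed.

Let gauss_tau z : is_gaussian (next_mean z) W (tau z).
Proof. by case: z => x u; exact: htau. Qed.

Let mixE (E : set 'cV[R]_n) : mixture tau mu E = (\int[mu]_z tau z E)%E.
Proof. by []. Qed.

(** [integral_mixture] presupposes integrability, so the nonnegative version is applied to [normsq]:
    the inner integral is [\tr W + normsq (next_mean z)], which is [mu]-integrable. *)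
Lemma square_integrable_mixture : square_integrable (mixture tau mu) id.
Proof.
split; first by move=> i; exact: measurable_coord.
have mN : measurable_fun setT (EFin \o (fun y : 'cV[R]_n => normsq y)).
  apply/measurable_EFinP; apply: measurable_sum => i; apply: measurable_funX.
  exact: measurable_coord.
have N0 (y : 'cV[R]_n) : 0 <= normsq y by rewrite sumr_ge0// => i _; exact: sqr_ge0.
apply/integrableP; split => //.
under eq_integral do rewrite /= ger0_norm ?N0//.
rewrite (@ge0_integral_mixture _ _ _ _ _ tau mu)//; last first.
  by move=> U mU; exact: measurable_kernel.
rewrite (eq_integral (EFin \o (fun z => \tr W + normsq (next_mean z)))).
  apply: integrable_lty => //.
  exact: (integrableD measurableT (integrableT_cst mufin (\tr W))
                                  square_integrable_next_mean.2).
move=> z _.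
have sq := square_integrable_gaussian hW (tau1 z) (gauss_tau z).
rewrite -[LHS]fineK; last exact: integrable_fin_num sq.2.
congr EFin; have := Rintegral_normsq sq; rewrite /Rintegral => ->.
rewrite (mom2_gaussian hW (tau1 z) (gauss_tau z)) linearD /=; congr (_ + _).
apply: eq_bigr => i _; rewrite mxE big_ord1 !mxE expr2; congr (_ * _).
Qed.

Let mixfin : (mixture tau mu setT < +oo)%E.
Proof. by rewrite ltey_eq fin_num_measure. Qed.

Let Rintegral_mixture (f : 'cV[R]_n -> R) (g : _ -> R) :
  (forall z, (tau z).-integrable setT (EFin \o f)) ->
  (mixture tau mu).-integrable setT (EFin \o f) ->
  (forall z, \int[tau z]_y f y = g z) ->
  \int[mixture tau mu]_y f y = \int[mu]_z g z.
Proof.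
move=> tf mf fg; rewrite /Rintegral; congr fine.
rewrite (@integral_mixture _ _ _ _ _ tau mu)//; last first.
  by move=> U mU; exact: measurable_kernel.
apply: eq_integral => z _; rewrite -fg /Rintegral fineK//.
exact: integrable_fin_num (tf z).
Qed.

Lemma mass_mixture : mixture tau mu setT = mu setT.
Proof.
rewrite mixE; under eq_integral do rewrite prob_kernel.
by rewrite integral_cst// mul1e.
Qed.

Lemma mom1_mixture : mom1 (mixture tau mu) id =
  A *m v_mx (moments mu) + B *m v_mu (moments mu).
Proof.
rewrite -mom1_next_mean; apply/matrixP => i j; rewrite !mxE.
have sq z := square_integrable_gaussian hW (tau1 z) (gauss_tau z).
apply: Rintegral_mixture => [z| |z].
- by apply: (integrable_coord (sq z)); rewrite tau1 ltry.
- exact: (integrable_coord square_integrable_mixture mixfin).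
- have := mom1_gaussian hW (tau1 z) (gauss_tau z).
  by move/matrixP => /(_ i 0); rewrite mxE.
Qed.

Lemma mom2_mixture : mom2 (mixture tau mu) id =
  A *m v_Zxx (moments mu) *m A^T + A *m v_Zxu (moments mu) *m B^T +
  B *m (v_Zxu (moments mu))^T *m A^T + B *m v_Zuu (moments mu) *m B^T +
  v_m (moments mu) *: W.
Proof.
rewrite -mom2_next_mean; apply/matrixP => i j; rewrite !mxE.
have sq z := square_integrable_gaussian hW (tau1 z) (gauss_tau z).
rewrite (@Rintegral_mixture _
  (fun z => next_mean z i 0 * next_mean z j 0 + W i j)).
- rewrite RintegralD//; last 2 first.
  + exact: integrable_coordM square_integrable_next_mean i j.
  + exact: integrableT_cst.
  by rewrite Rintegral_cst// mulrC.
- by move=> z; exact: integrable_coordM.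
- exact: integrable_coordM square_integrable_mixture i j.
- move=> z; have := mom2_gaussian hW (tau1 z) (gauss_tau z).
  move/matrixP => /(_ i j); rewrite mxE => ->.
  by rewrite !mxE big_ord1 !mxE addrC.
Qed.

End controlled_kernel.

(** * The residual of the linear program *)

Lemma eq0_of_normsq {R : realType} n (x : 'cV[R]_n) : (x^T *m x) 0 0 = 0 -> x = 0.
Proof.
rewrite dotE => /eqP; rewrite psumr_eq0 => [/allP x0|i _]; last first.
  by rewrite -expr2 sqr_ge0.
apply/matrixP => i j; rewrite ord1 mxE.
by have := x0 i (mem_index_enum i); rewrite /= mulf_eq0 orbb => /eqP.
Qed.

(** For symmetric [M] the trace of [M *m M] is the sum of the squared entries. *)
Lemma eq0_of_trace_sqr {R : realType} n (M : 'M[R]_n) :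
  M^T = M -> \tr (M *m M) = 0 -> M = 0.
Proof.
move=> sM; have -> : \tr (M *m M) = \sum_i \sum_j M i j ^+ 2.
  apply: eq_bigr => i _; rewrite mxE; apply: eq_bigr => j _.
  by rewrite -{2}sM mxE expr2.
move=> /eqP; rewrite psumr_eq0 => [/allP M0|i _]; last first.
  by rewrite sumr_ge0// => j _; exact: sqr_ge0.
apply/matrixP => i j; rewrite mxE.
have := M0 i (mem_index_enum i).
rewrite /= psumr_eq0 => [/allP|k _]; last exact: sqr_ge0.
by move=> /(_ j (mem_index_enum j)); rewrite /= sqrf_eq0 => /eqP.
Qed.

Section residual.
Context (R : realType) (n m : nat).
Variables (A : 'M[R]_n) (B : 'M[R]_(n, m)) (W : 'M[R]_n) (alpha : R).
Variable nu0 : probability 'cV[R]_n R.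
Variable tau : R.-pker ('cV[R]_n * 'cV[R]_m)%type ~> 'cV[R]_n.
Hypothesis htau : forall x u, is_gaussian (A *m x + B *m u) W (tau (x, u)).
Hypothesis hW : is_psd W.
Hypothesis alpha0 : 0 <= alpha.
Hypothesis hnu0 : second_moments1 nu0.
Variable mu : {finite_measure set ('cV[R]_n * 'cV[R]_m)%type -> \bar R}.
Hypothesis hmu : in_Mplus mu.

Let p : {measure set 'cV[R]_n -> \bar R} :=
  measure_add nu0 (mscale (NngNum alpha0) (mixture tau mu)).

Let q : {measure set 'cV[R]_n -> \bar R} :=
  measure_function_pushforward__canonical__measure_function_Measure mu
    (@measurable_fst _ _ 'cV[R]_n 'cV[R]_m).

Let mufin : (mu setT < +oo)%E.
Proof. by rewrite ltey_eq fin_num_measure. Qed.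

Let nu0fin : (nu0 setT < +oo)%E.
Proof. by rewrite probability_setT ltry. Qed.

Let mixfin : (mixture tau mu setT < +oo)%E.
Proof. by rewrite ltey_eq fin_num_measure. Qed.

Let pE E : p E = (nu0 E + alpha%:E * mixture tau mu E)%E.
Proof. exact: measure_addE. Qed.

Let pfin : (p setT < +oo)%E.
Proof.
by rewrite pE lte_add_pinfty// lte_mul_pinfty// lee_fin.
Qed.

Let integrable_tau E : measurable E -> mu.-integrable setT (fun z => tau z E).
Proof.
move=> mE; apply: le_integrable (integrableT_cst mufin 1) => //.
  exact: measurable_kernel.
move=> z _; rewrite gee0_abs//= normr1 -(@prob_kernel _ _ _ _ _ tau z).
by apply: le_measure; rewrite ?inE.
Qed.

Lemma residualE E : measurable E -> residual alpha tau nu0 mu E = (p E - q E)%E.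
Proof.
move=> mE; rewrite pE.
transitivity (nu0 E - (mu (E `*` setT) - alpha%:E * \int[mu]_z tau z E))%E.
  by rewrite -(cint_finite_measure (integrable_tau mE)).
have -> : q E = mu (E `*` setT).
  by congr (mu _); apply/seteqP; split=> -[x u] //= [].
have mET : measurable (E `*` [set: 'cV[R]_m]) by exact: measurableX.
have fmu : mu (E `*` setT) \is a fin_num := fin_num_measure _ _ mET.
have fnu0 : nu0 E \is a fin_num := fin_num_measure _ _ mE.
have fmix : (\int[mu]_z tau z E)%E \is a fin_num.
  exact: (@fin_num_measure _ _ _ (mixture tau mu) _ mE).
rewrite /mixture; move: fmu fnu0 fmix.
move: (mu (E `*` setT)) (nu0 E) (\int[mu]_z tau z E)%E => [a| |]// [b| |]// [c| |]//.
by move=> _ _ _; rewrite -!(EFinM, EFinB, EFinD); congr EFin; ring.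
Qed.

Let sq_nu0 : square_integrable nu0 id.
Proof. by split => // i; exact: measurable_coord. Qed.

Let sq_mix := square_integrable_mixture htau hW hmu.
Let sq_fst := square_integrable_state hmu.

Lemma pairing_residual v : in_F v ->
  pairing (residual alpha tau nu0 mu) v =
  (\int[nu0]_x v x + alpha * \int[mixture tau mu]_x v x - \int[mu]_z v z.1)%:E.
Proof.
move=> Fv.
have mv : measurable_fun setT (EFin \o v) by apply/measurable_EFinP; case: Fv.
have i0 := integrable_quadratic_growth nu0fin sq_nu0 Fv.
have i1 := integrable_quadratic_growth mixfin sq_mix Fv.
have i1' := integrable_mscale (NngNum alpha0) i1.
have sq_q : square_integrable q id.
  split; first by move=> i; exact: measurable_coord.
  apply: integrable_pushforward => //; last exact: sq_fst.2.
  exact: measurable_int _ hnu0.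
have qfin : (q setT < +oo)%E by exact: mufin.
have iq := integrable_quadratic_growth qfin sq_q Fv.
have imu : mu.-integrable setT (EFin \o (fun z => v z.1)).
  move/integrableP: iq => [_ iq]; apply/integrableP; split.
    exact: measurableT_comp mv measurable_fst.
  by move: iq; rewrite ge0_integral_pushforward//; exact: measurableT_comp.
rewrite /pairing (@cint_difference _ _ _ _ p q)//; first last.
- exact: integrable_measure_add.
- exact: residualE.
rewrite /p integral_measure_add// integral_mscale// integral_pushforward//.
rewrite -(fineK (integrable_fin_num measurableT i0)).
rewrite -(fineK (integrable_fin_num measurableT i1)).
by rewrite -[X in (_ - X)%E](fineK (integrable_fin_num measurableT imu)).
Qed.

Let C0 : R := alpha * v_m (moments mu) - v_m (moments mu) + 1.

Let C1 := mean nu0 - v_mx (moments mu) +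
  alpha *: (A *m v_mx (moments mu) + B *m v_mu (moments mu)).

Let C2 := covariance_mx nu0 + mean nu0 *m (mean nu0)^T - v_Zxx (moments mu) +
  alpha *: (A *m v_Zxx (moments mu) *m A^T + A *m v_Zxu (moments mu) *m B^T +
            B *m (v_Zxu (moments mu))^T *m A^T +
            B *m v_Zuu (moments mu) *m B^T + v_m (moments mu) *: W).

Let C1E : C1 = mom1 nu0 id - mom1 mu (fun z => z.1) +
  alpha *: mom1 (mixture tau mu) id.
Proof. by rewrite (mom1_mixture htau hW hmu). Qed.

Let C2E : C2 = mom2 nu0 id - mom2 mu (fun z => z.1) +
  alpha *: mom2 (mixture tau mu) id.
Proof.
rewrite (mom2_mixture htau hW hmu).
by rewrite -(mom2_centered (@probability_setT _ _ _ nu0) sq_nu0).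
Qed.

(** Makes [C2] itself admissible as the matrix of a test function in [in_Fhat]. *)
Let C2_sym : C2^T = C2.
Proof. by rewrite C2E !(linearD, linearN, linearZ)/= !mom2_sym. Qed.

Let pairing_quadratic (P : 'M[R]_n) (b : 'cV[R]_n) (r : R) : P^T = P ->
  pairing (residual alpha tau nu0 mu)
    (fun x => (x^T *m P *m x) 0 0 + (b^T *m x) 0 0 + r) =
  (\tr (P *m C2) + (b^T *m C1) 0 0 + r * C0)%:E.
Proof.
move=> sP; rewrite pairing_residual; last first.
  by apply: in_F_quadratic; exists P, b, r.
rewrite (Rintegral_quadratic nu0fin sq_nu0) (Rintegral_quadratic mixfin sq_mix).
rewrite (Rintegral_quadratic mufin sq_fst) C1E C2E /C0 /=.
rewrite mass_mixture probability_setT /=; congr EFin.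
(* The moments are abstracted into variables, leaving an identity that follows from linearity
   alone. *)
have pairing_alg (a2 b2 c2 : 'M[R]_n) (a1 b1 c1 : 'cV[R]_n) (k : R) :
    \tr (P *m a2) + (b^T *m a1) 0 0 + r * 1 +
      alpha * (\tr (P *m b2) + (b^T *m b1) 0 0 + r * k) -
      (\tr (P *m c2) + (b^T *m c1) 0 0 + r * k) =
    \tr (P *m (a2 - c2 + alpha *: b2)) +
      (b^T *m (a1 - c1 + alpha *: b1)) 0 0 + r * (alpha * k - k + 1).
  rewrite !mulmxDr !mxtraceD !mulmxN !linearN/= -!scalemxAr !mxtraceZ.
  have e (x y z : 'M[R]_1) : (x - y + alpha *: z) 0 0 =
    x 0 0 - y 0 0 + alpha * z 0 0 by rewrite !mxE.
  by rewrite e; ring.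
exact: pairing_alg.
Qed.

Lemma quadratic_residual_iff :
  (forall v, in_Fhat v -> pairing (residual alpha tau nu0 mu) v = 0%E) <->
  [/\ constraint_C0 alpha (moments mu),
      constraint_C1 A B alpha (mean nu0) (moments mu)
    & constraint_C2 A B W alpha (mean nu0) (covariance_mx nu0) (moments mu)].
Proof.
rewrite /constraint_C0 /constraint_C1 /constraint_C2 -/C0 -/C1 -/C2.
split=> [h|[h0 h1 h2] _ [P [b [r [sP ->]]]]]; last first.
  by rewrite pairing_quadratic// h0 h1 h2 !mulmx0 mxtrace0 mxE mulr0 !addr0.
have {}h (P : 'M[R]_n) (b : 'cV[R]_n) r : P^T = P ->
    \tr (P *m C2) + (b^T *m C1) 0 0 + r * C0 = 0.
  move=> sP; have := pairing_quadratic b r sP; rewrite h => [[]//|].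
  by exists P, b, r.
split.
- have := h 0 0 1 (trmx0 _ _ _).
  by rewrite trmx0 !mul0mx mxtrace0 mxE !add0r mul1r.
- apply: eq0_of_normsq; have := h 0 C1 0 (trmx0 _ _ _).
  by rewrite mul0mx mxtrace0 add0r mul0r addr0.
- apply: eq0_of_trace_sqr => //; have := h C2 0 0 C2_sym.
  by rewrite trmx0 mul0mx mxE mul0r !addr0.
Qed.

(** Indicators are bounded by 1 and so belong to [in_F]; pairing with [\1_E] returns the value of
    the residual on [E]. *)
Lemma residual_eq0_iff :
  (forall E, measurable E -> residual alpha tau nu0 mu E = 0%E) <->
  (forall v, in_F v -> pairing (residual alpha tau nu0 mu) v = 0%E).
Proof.
split=> [h v Fv|h E mE].
  have v0 : (@mzero _ 'cV[R]_n R).-integrable setT (EFin \o v).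
    apply/integrableP; split; last by rewrite integral_measure_zero.
    by apply/measurable_EFinP; case: Fv.
  (* A charge vanishing on measurable sets is the difference of two zero measures. *)
  rewrite /pairing (@cint_difference _ _ _ _ mzero mzero)//.
  - by rewrite !integral_measure_zero sube0.
  - by rewrite /mzero ltry.
  - by rewrite /mzero ltry.
  - by move=> E mE; rewrite h// /mzero sube0.
have F1 : in_F (\1_E : 'cV[R]_n -> R).
  split; first exact: measurable_indic.
  exists 1 => x; have x0 : 0 <= normsq x.
    by rewrite sumr_ge0// => i _; exact: sqr_ge0.
  rewrite mul1r indicE normr_nat; apply: (@le_trans _ _ 1); last by rewrite lerDl.
  by rewrite lern1 leq_b1.
have := h _ F1; rewrite pairing_residual// residualE// pE.
have mE1 : measurable ((fun z : 'cV[R]_n * 'cV[R]_m => z.1) @^-1` E).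
  by rewrite -[X in measurable X]setTI; exact: measurable_fst.
have -> : \int[mu]_z \1_E z.1 = fine (q E).
  transitivity (fine (\int[mu]_z (\1_(fst @^-1` E) z)%:E)) => //.
  by rewrite integral_indic// setIT.
rewrite /Rintegral !integral_indic// !setIT => -[e].
have fq : q E \is a fin_num := fin_num_measure mu _ mE1.
have fnu0 : nu0 E \is a fin_num := fin_num_measure _ _ mE.
have fmix : mixture tau mu E \is a fin_num := fin_num_measure _ _ mE.
rewrite -(fineK fq) -(fineK fnu0) -(fineK fmix) -!(EFinM, EFinB, EFinD).
by congr EFin; exact: e.
Qed.

End residual.

(** * Positivity of the moment matrix and the cost as a function of moments *)

Section moments_of_measure.
Context (R : realType) (n m : nat).
Variable mu : {finite_measure set ('cV[R]_n * 'cV[R]_m)%type -> \bar R}.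
Hypothesis hmu : in_Mplus mu.

Let mufin : (mu setT < +oo)%E.
Proof. by rewrite ltey_eq fin_num_measure. Qed.

Lemma moments_psd : constraint_Cp (moments mu).
Proof.
pose w (z : 'cV[R]_n * 'cV[R]_m) := col_mx z.1 z.2.
have w2 := square_integrable_col_mx (square_integrable_state hmu)
  (square_integrable_control hmu).
have one2 : square_integrable mu (fun=> 1%:M : 'cV[R]_1).
  split; first by move=> i; exact: measurable_cst.
  exact: (integrableT_cst mufin (normsq (1%:M : 'cV[R]_1))).
have := mom2_psd (square_integrable_col_mx one2 w2).
rewrite mom2_col_mx mom2_col_mx /constraint_Cp.
(* Pairing with the constant 1 turns a cross moment into a first moment, which fills the border of
   the matrix. *)
have crossE : cross_mom mu (fun=> 1%:M) w =
    row_mx (v_mx (moments mu))^T (v_mu (moments mu))^T.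
  rewrite -tr_col_mx -[in RHS]mom1_col_mx; apply/matrixP => i j; rewrite !mxE.
  by apply: eq_Rintegral => z _; rewrite !ord1 !mxE mul1r.
rewrite crossE tr_row_mx !trmxK.
suff -> : mom2 mu (fun=> 1%:M : 'cV[R]_1) = (v_m (moments mu))%:M by [].
apply/matrixP => i j; rewrite !ord1 !mxE /= Rintegral_cst//.
by rewrite !mulr1n !mul1r.
Qed.

Lemma cost_moments (Q0 : 'M[R]_n) (R0 : 'M[R]_m) :
  (\int[mu]_z (cost Q0 R0 z)%:E)%E = (lqg_obj Q0 R0 (moments mu))%:E.
Proof.
have ix := integrable_quad (square_integrable_state hmu) Q0.
have iu := integrable_quad (square_integrable_control hmu) R0.
have ixu := integrableD measurableT ix iu.
rewrite -[LHS]fineK; last exact: (integrable_fin_num measurableT ixu).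
congr EFin; rewrite -/(Rintegral mu setT (cost Q0 R0)) /cost.
rewrite RintegralD// (Rintegral_quad (square_integrable_state hmu)).
by rewrite (Rintegral_quad (square_integrable_control hmu)).
Qed.

End moments_of_measure.

Theorem proposition2 (R : realType) (n m p : nat)
    (A : 'M[R]_n) (B : 'M[R]_(n, m)) (C : 'M[R]_(p, n)) (W : 'M[R]_n)
    (Q0 : 'M[R]_n) (R0 : 'M[R]_m) (alpha : R)
    (nu0 : probability 'cV[R]_n R)
    (tau : R.-pker ('cV[R]_n * 'cV[R]_m)%type ~> 'cV[R]_n)
    (hAB : controllable A B) (hAC : observable A C)
    (hQ0 : Q0 = C^T *m C) (hR0 : is_pd R0)
    (halpha : 0 < alpha < 1)
    (hW : is_psd W)
    (htau : forall (x : 'cV[R]_n) (u : 'cV[R]_m),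
       is_gaussian (A *m x + B *m u) W (tau (x, u)))
    (hnu0 : second_moments1 nu0) :
  let m0 := mean nu0 in
  let Sigma0 := covariance_mx nu0 in
  [/\ (* the constraint of (P-SC) tested against the functions in F *)
      forall mu : {finite_measure set ('cV[R]_n * 'cV[R]_m)%type -> \bar R},
        in_Mplus mu ->
        ((forall E : set 'cV[R]_n, measurable E ->
            residual alpha tau nu0 mu E = 0%E) <->
         (forall v : 'cV[R]_n -> R, in_F v ->
            pairing (residual alpha tau nu0 mu) v = 0%E)),
      (* (i) *)
      forall mu : {finite_measure set ('cV[R]_n * 'cV[R]_m)%type -> \bar R},
        in_Mplus mu ->
        [/\ (forall v : 'cV[R]_n -> R, in_Fhat v ->
                pairing (residual alpha tau nu0 mu) v = 0%E) <->
            [/\ constraint_C0 alpha (moments mu),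
                constraint_C1 A B alpha m0 (moments mu)
              & constraint_C2 A B W alpha m0 Sigma0 (moments mu)],
            constraint_Cp (moments mu)
          & (\int[mu]_z (cost Q0 R0 z)%:E)%E =
            (lqg_obj Q0 R0 (moments mu))%:E],
      (* (ii) *)
      forall mu : {finite_measure set ('cV[R]_n * 'cV[R]_m)%type -> \bar R},
        psc_feasible alpha tau nu0 mu ->
        lqg_feasible A B W alpha m0 Sigma0 (moments mu) /\
        (lqg_obj Q0 R0 (moments mu))%:E =
        (\int[mu]_z (cost Q0 R0 z)%:E)%E
    & (lqg_value A B W alpha m0 Sigma0 Q0 R0 <=
       psc_value Q0 R0 alpha tau nu0)%E].
Proof.
move=> m0 Sigma0.
have alpha0 : 0 <= alpha by case/andP: halpha => /ltW.
have iff_F mu (hmu : in_Mplus mu) :=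
  @residual_eq0_iff R n m A B W alpha nu0 tau htau hW alpha0 hnu0 mu hmu.
have iff_Fhat mu (hmu : in_Mplus mu) :=
  @quadratic_residual_iff R n m A B W alpha nu0 tau htau hW alpha0 hnu0 mu hmu.
have feasible mu : psc_feasible alpha tau nu0 mu ->
    lqg_feasible A B W alpha m0 Sigma0 (moments mu) /\
    (lqg_obj Q0 R0 (moments mu))%:E = (\int[mu]_z (cost Q0 R0 z)%:E)%E.
  move=> [hmu res0]; rewrite cost_moments//; split => //.
  have [c0 c1 c2] : [/\ constraint_C0 alpha (moments mu),
      constraint_C1 A B alpha m0 (moments mu)
    & constraint_C2 A B W alpha m0 Sigma0 (moments mu)].
    apply/(iff_Fhat mu hmu) => v /in_F_quadratic Fv.
    exact: (iff_F mu hmu).1.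
  split => //; [exact: mom2_sym|exact: mom2_sym|].
  by split => //; exact: moments_psd.
split => [mu hmu|mu hmu|//|]; first exact: iff_F.
  by split; [exact: iff_Fhat|exact: moments_psd|exact: cost_moments].
(* Every cost attained in (P-SC) is attained in (P-LQG) by the moments, so one infimum runs over a
   larger set; this also covers an infeasible (P-SC). *)
apply: le_ereal_inf => _ [mu mu_feas <-].
have [mom_feas <-] := feasible mu mu_feas.
by exists (moments mu).
Qed.
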